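(* For $0<r<1$, the function $X_r^{\mathcal F}(t)$ has the Mellin transform representation $$X_r^{\mathcal F}(t)=\int_0^\infty\omega_r(x)\,x^{-\frac34+\frac{it}{2}}\,dx\qquad(t\in\mathbb{C}),$$ where $$\omega_r(x)=\begin{cases}\dfrac{1+\eta}{\sqrt{1-\eta}}\,\dfrac{1}{\sqrt{1-\eta x}}\,\omega\left(\dfrac{x-\eta}{1-\eta x}\right)&\text{if }\eta<x<1/\eta,\\[2mm]0&\text{otherwise,}\end{cases}\qquad\text{with }\ \eta=\frac{1-r}{1+r}.$$
   Context: For $x>0$ let $\omega(x)=\sum_{m=1}^\infty(2\pi^2m^4x^2-3\pi m^2x)e^{-\pi m^2x}$. For $n\ge0$ define $$c_n=2\sqrt2\int_0^\infty\frac{\omega(x)}{(x+1)^{3/2}}\left(\frac{x-1}{x+1}\right)^n\,dx .$$ The polynomials $f_n$ (Meixner--Pollaczek polynomials $P_n^{(3/4)}(x;\pi/2)$) are $$f_n(x)=\frac{(3/2)_n}{n!}\,i^n\,{}_2F_1\left(-n,\tfrac34+ix;\tfrac32;2\right),$$ where $(a)_n=a(a+1)\cdots(a+n-1)$. The function $\Xi(t)=\xi\left(\frac12+it\right)$, with $\xi(s)=\frac12 s(s-1)\pi^{-s/2}\Gamma(s/2)\zeta(s)$, has the expansion $\Xi(t)=\sum_{n=0}^\infty i^nc_nf_n(t/2)$ (with $c_n=0$ for odd $n$). The Poisson flow of $\Xi$ associated with the family $\mathcal F=(f_n)_{n\ge0}$ is $$X_r^{\mathcal F}(t)=\sum_{n=0}^\infty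 i^nc_nr^nf_n\left(\frac t2\right)\qquad(0<r\le1,\ t\in\mathbb{C}).$$ *)

(* Defs.v *)
From mathcomp Require Import all_boot all_order all_algebra.
From mathcomp Require Import all_classical all_reals all_analysis.
From mathcomp Require Import complex.

Set Implicit Arguments.
Unset Strict Implicit.
Unset Printing Implicit Defensive.

Import Order.TTheory GRing.Theory Num.Theory.
Import numFieldNormedType.Exports.

Local Open Scope classical_set_scope.
Local Open Scope ring_scope.
Local Open Scope complex_scope.

(* Complex sequences are typed in [R[i]^o], which carries the topology given by
   the complex modulus. *)

Section ComplexAnalysis.
Context {R : realType}.
Implicit Types (D : set R) (f : R -> R[i]).

(* Lebesgue integrability and integral of complex-valued functions.  The
   qualified [complex.Re] and [complex.Im] take values in [R], whereas
   ['Re] and ['Im] take values in [R[i]]. *)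
Definition cintegrable D f : Prop :=
  (@lebesgue_measure R).-integrable D (fun x => (complex.Re (f x))%:E) /\
  (@lebesgue_measure R).-integrable D (fun x => (complex.Im (f x))%:E).

Definition cintegral D f : R[i] :=
  (\int[@lebesgue_measure R]_(x in D) complex.Re (f x)) +i*
  (\int[@lebesgue_measure R]_(x in D) complex.Im (f x)).

(* x ^ s = exp (s * log x), meaningful for 0 < x. *)
Definition cpow (x : R) (s : R[i]) : R[i] :=
  (expR (complex.Re s * ln x))%:C *
  (cos (complex.Im s * ln x) +i* sin (complex.Im s * ln x)).

Definition pochhammer (a : R[i]) (n : nat) : R[i] := \prod_(k < n) (a + k%:R).

(* Gauss's 2F1 as the sum of its defining series; for a = - n the terms with
   index k > n vanish. *)
Definition hyp2F1 (a b c z : R[i]) : R[i] :=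
  limn (series (fun k : nat =>
    pochhammer a k * pochhammer b k / pochhammer c k * z ^+ k / k`!%:R
      : R[i]^o)).

End ComplexAnalysis.

Section PoissonFlow.
Context {R : realType}.

Definition omega (x : R) : R :=
  limn (fun N : nat => \sum_(1 <= m < N)
    (2 * pi ^+ 2 * m%:R ^+ 4 * x ^+ 2 - 3 * pi * m%:R ^+ 2 * x)
      * expR (- (pi * m%:R ^+ 2 * x))).

Definition coef_c (n : nat) : R :=
  2 * Num.sqrt 2 *
  \int[@lebesgue_measure R]_(x in `]0, +oo[)
    (omega x / (x + 1) `^ (3 / 2) * ((x - 1) / (x + 1)) ^+ n).

Definition poly_f (n : nat) (x : R[i]) : R[i] :=
  pochhammer (3 / 2) n / n`!%:R * 'i ^+ n *
  hyp2F1 (- n%:R) (3 / 4 + 'i * x) (3 / 2) 2.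

Definition flow_term (r : R) (t : R[i]) (n : nat) : R[i]^o :=
  'i ^+ n * (coef_c n)%:C * r%:C ^+ n * poly_f n (t / 2).

Definition poisson_flow (r : R) (t : R[i]) : R[i] :=
  limn (series (flow_term r t)).

Definition eta (r : R) : R := (1 - r) / (1 + r).

Definition omega_r (r x : R) : R :=
  if (eta r < x) && (x < (eta r)^-1) then
    (1 + eta r) / Num.sqrt (1 - eta r) * (1 / Num.sqrt (1 - eta r * x)) *
    omega ((x - eta r) / (1 - eta r * x))
  else 0.

Definition mellin_integrand (r : R) (t : R[i]) (x : R) : R[i] :=
  (omega_r r x)%:C * cpow x (- (3 / 4) + 'i * t / 2).

End PoissonFlow.

(* Main.v *)
Require Import Defs.
From mathcomp Require Import all_boot all_order all_algebra.
From mathcomp Require Import all_classical all_reals all_analysis.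
From mathcomp Require Import complex.
From mathcomp Require Import measurable_realfun.
From mathcomp Require Import ring lra.
Import Order.TTheory GRing.Theory Num.Theory.
Import numFieldNormedType.Exports.
Import ComplexField.Normc.
Local Open Scope classical_set_scope.
Local Open Scope ring_scope.
Local Open Scope complex_scope.

Set Implicit Arguments.
Unset Strict Implicit.
Unset Printing Implicit Defensive.

(** Write [u = (y - 1) / (y + 1)], [b = 3/4 + i t/2] and [eta] for
    [(1 - r) / (1 + r)].  The idea is to sum the series under the integral sign
    of the coefficients [c_n].

    The numbers [a_n = i ^ n f_n (t/2)] are the Taylor coefficients of
    [(1 + w) ^ (b - 3/2) * (1 - w) ^ (- b)] on [-1 < w < 1]
    ([mp_generating_function]).  This comes from a three-term recurrence
    ([mp_poly_rec]), read off the terminating hypergeometric sum: it turns into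
    the first order differential equation
    [(1 - w ^ 2) G' = (2 b - 3/2 + 3/2 w) G] for the generating series, which
    the closed form solves.  The recurrence also bounds [a_n] by the
    coefficients of some [(1 - w) ^ (- K)] ([mp_poly_growth]), so that
    [sum |a_n| r ^ n] is finite.

    The function [omega] is Lebesgue integrable on the half-line
    ([integrable_omega]): its [m]-th term is at most [38 exp (- m ^ 2 x)], whose
    integral is [38 / m ^ 2].  As [|u| <= 1], dominated convergence
    ([cvg_series_Rintegral]) gives that [sum c_n r ^ n a_n] converges to the
    integral over [y > 0] of [2 sqrt 2 omega(y) (y + 1) ^ (- 3/2)] times
    [(1 + r u) ^ (b - 3/2) (1 - r u) ^ (- b)].

    Finally the substitution [x = (y + eta) / (1 + eta y)] maps the half-line
    onto the interval from [eta] to [1 / eta]; since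
    [x = (1 + r u) / (1 - r u)], it carries [omega_r x * x ^ (-3/4 + i t/2) dx]
    to exactly this integrand ([mellin_integrand_mobius]).  The substitution
    is justified by the continuity of [omega] ([continuous_omega]).  Integrals,
    derivatives and limits of complex functions are handled through their real
    and imaginary parts. *)

(** * Complex numbers and functions by real and imaginary parts *)

Section ComplexParts.
Context {R : realType}.
Implicit Types (x y : R[i]).

Lemma Re_cplxD x y : complex.Re (x + y) = complex.Re x + complex.Re y.
Proof. by case: x => a b; case: y. Qed.

Lemma Im_cplxD x y : complex.Im (x + y) = complex.Im x + complex.Im y.
Proof. by case: x => a b; case: y. Qed.

Lemma Re_cplxM x y : complex.Re (x * y) =
  complex.Re x * complex.Re y - complex.Im x * complex.Im y.
Proof. by case: x => a b; case: y. Qed.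

Lemma Im_cplxM x y : complex.Im (x * y) =
  complex.Re x * complex.Im y + complex.Im x * complex.Re y.
Proof. by case: x => a b; case: y. Qed.

Lemma Re_real_cplxM (a : R) x : complex.Re (a%:C * x) = a * complex.Re x.
Proof. by rewrite Re_cplxM mul0r subr0. Qed.

Lemma Im_real_cplxM (a : R) x : complex.Im (a%:C * x) = a * complex.Im x.
Proof. by rewrite Im_cplxM mul0r addr0. Qed.

Lemma eq_cplx x y : complex.Re x = complex.Re y -> complex.Im x = complex.Im y ->
  x = y.
Proof. by move: x y => [a b] [c d] /= -> ->. Qed.

Lemma Re_cplx_sum I (s : seq I) (F : I -> R[i]) :
  complex.Re (\sum_(i <- s) F i) = \sum_(i <- s) complex.Re (F i).
Proof. exact: (big_morph _ Re_cplxD). Qed.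

Lemma Im_cplx_sum I (s : seq I) (F : I -> R[i]) :
  complex.Im (\sum_(i <- s) F i) = \sum_(i <- s) complex.Im (F i).
Proof. exact: (big_morph _ Im_cplxD). Qed.

Lemma normc_real (a : R) : normc a%:C = `|a|.
Proof. by rewrite /= expr0n addr0 sqrtr_sqr. Qed.

Lemma Re_le_normc x : `|complex.Re x| <= normc x.
Proof. by rewrite -lecR; exact: normc_ge_Re. Qed.

Lemma Im_le_normc x : `|complex.Im x| <= normc x.
Proof. by case: x => a b /=; rewrite -sqrtr_sqr ler_wsqrtr// lerDr sqr_ge0. Qed.

Lemma normc_le x : normc x <= `|complex.Re x| + `|complex.Im x|.
Proof.
rewrite {1}[x]complexE (le_trans (le_normcD _ _))// normcM !normc_real.
by rewrite /= expr0n add0r expr1n sqrtr1 mul1r.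
Qed.

Lemma normc_ge0 x : 0 <= normc x.
Proof. by case: x => a b; exact: sqrtr_ge0. Qed.

(** The modulus is at most the sum of the absolute values of the two parts, so
    convergence in [R[i]] reduces to convergence of real sequences. *)
Lemma cvg_cplx (u : nat -> R[i]^o) (l : R[i]^o) :
  (fun n => complex.Re (u n)) @ \oo --> complex.Re l ->
  (fun n => complex.Im (u n)) @ \oo --> complex.Im l ->
  u @ \oo --> l.
Proof.
move=> /cvgrPdist_lt cR /cvgrPdist_lt cI; apply/cvgrPdist_lt => -[e e'].
rewrite ltcE => /andP[/eqP /= -> e0].
have e20 : 0 < e / 2 by rewrite divr_gt0.
near=> n.
rewrite (_ : `|l - u n| = (normc (l - u n))%:C)//.
rewrite complexr0 ltcR (le_lt_trans (normc_le _))//.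
rewrite (splitr e) ltrD//.
  rewrite (_ : complex.Re _ = complex.Re l - complex.Re (u n)).
    by near: n; exact: cR.
  by case: (l) (u n) => ? ? [].
rewrite (_ : complex.Im _ = complex.Im l - complex.Im (u n)).
  by near: n; exact: cI.
by case: (l) (u n) => ? ? [].
Unshelve. all: by end_near. Qed.
End ComplexParts.

Section ComplexDerivative.
Context {R : realType}.
Implicit Types (f g : R -> R[i]) (x : R) (z s : R[i]).

(** The variable is real and the values complex, a combination for which the
    derivative is defined by parts. *)
Definition is_cderive x f z :=
  is_derive x (1 : R) (fun y => complex.Re (f y)) (complex.Re z) /\
  is_derive x (1 : R) (fun y => complex.Im (f y)) (complex.Im z).

Lemma is_cderiveM x f g df dg : is_cderive x f df -> is_cderive x g dg ->
  is_cderive x (fun y => f y * g y) (df * g x + f x * dg).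
Proof.
move=> [fR fI] [gR gI]; split.
  rewrite Re_cplxD !Re_cplxM.
  under eq_fun do rewrite Re_cplxM.
  apply: is_derive_eq.
  by rewrite /GRing.scale/=; ring.
rewrite Im_cplxD !Im_cplxM.
under eq_fun do rewrite Im_cplxM.
apply: is_derive_eq.
by rewrite /GRing.scale/=; ring.
Qed.

Lemma cpowD x s t : cpow x (s + t) = cpow x s * cpow x t.
Proof.
rewrite /cpow !Re_cplxD !Im_cplxD !mulrDl expRD cosD sinD rmorphM.
by apply: eq_cplx; simpc => /=; ring.
Qed.

Lemma cpow1 s : cpow (1 : R) s = 1.
Proof. by rewrite /cpow ln1 !mulr0 expR0 cos0 sin0 mul1r. Qed.

Lemma cpow0 x : cpow x 0 = 1.
Proof. by rewrite /cpow /= !mul0r expR0 cos0 sin0 mul1r. Qed.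

Lemma cpow_real x (a : R) : 0 < x -> cpow x a%:C = (x `^ a)%:C.
Proof.
by move=> x0; rewrite /cpow /= mul0r cos0 sin0 mulr1 /powR gt_eqF.
Qed.

Lemma cpowM x y s : 0 < x -> 0 < y -> cpow (x * y) s = cpow x s * cpow y s.
Proof.
move=> x0 y0; rewrite /cpow lnM// !mulrDr expRD cosD sinD.
by apply: eq_cplx; simpc => /=; ring.
Qed.

Lemma cpowV x s : 0 < x -> cpow x^-1 s = cpow x (- s).
Proof.
move=> x0; rewrite /cpow lnV//; case: s => a b /=; by rewrite !mulrN !mulNr.
Qed.

(** [h ^ s] is [exp (s * ln h)] cut into modulus and phase, whence the
    logarithmic derivative [s * h' / h]. *)
Lemma is_cderive_cpow (h : R -> R) x (dh : R) s :
  is_derive x (1 : R) h dh -> 0 < h x ->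
  is_cderive x (fun y => cpow (h y) s) ((dh / h x)%:C * s * cpow (h x) s).
Proof.
move=> hd h0; have lnd := is_derive1_ln h0; rewrite /cpow; case: s => a b /=.
have lnhd : is_derive x (1 : R) (fun y => ln (h y)) (dh / h x).
  by rewrite mulrC; exact: (@is_derive1_comp _ (@ln R)).
have [ad bd] : is_derive x (1 : R) (fun y => a * ln (h y)) (a * (dh / h x)) /\
    is_derive x (1 : R) (fun y => b * ln (h y)) (b * (dh / h x)).
  by split; apply: is_deriveZ.
have ed : is_derive x (1 : R) (fun y => expR (a * ln (h y)))
    (expR (a * ln (h x)) * (a * (dh / h x))).
  exact: (@is_derive1_comp _ expR).
have cd : is_derive x (1 : R) (fun y => cos (b * ln (h y)))
    (- sin (b * ln (h x)) * (b * (dh / h x))).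
  exact: (@is_derive1_comp _ cos).
have sd : is_derive x (1 : R) (fun y => sin (b * ln (h y)))
    (cos (b * ln (h x)) * (b * (dh / h x))).
  exact: (@is_derive1_comp _ sin).
split.
  under eq_fun do rewrite Re_real_cplxM /=.
  by apply: is_derive_eq; rewrite /GRing.scale/=; ring.
under eq_fun do rewrite Im_real_cplxM /=.
by apply: is_derive_eq; rewrite /GRing.scale/=; ring.
Qed.

Lemma is_cderive_continuous f x z : is_cderive x f z ->
  {for x, continuous (fun y => complex.Re (f y))} /\
  {for x, continuous (fun y => complex.Im (f y))}.
Proof.
by move=> [[fR _] [fI _]]; split;
  apply: differentiable_continuous; exact/derivable1_diffP.
Qed.
End ComplexDerivative.

(** * The three-term recurrence *)

Section MeixnerPollaczek.
Context {R : realType}.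
Implicit Types (a b x : R[i]) (n m k : nat).

Lemma pochhammerS a n : pochhammer a n.+1 = pochhammer a n * (a + n%:R).
Proof. by rewrite /pochhammer big_ord_recr. Qed.

Lemma pochhammer0 a : pochhammer a 0 = 1.
Proof. by rewrite /pochhammer big_ord0. Qed.

Lemma pochhammerD a m n :
  pochhammer a (m + n) = pochhammer a m * pochhammer (a + m%:R) n.
Proof.
elim: n => [|n ih]; first by rewrite addn0 pochhammer0 mulr1.
by rewrite addnS !pochhammerS ih natrD addrA mulrA.
Qed.

Lemma pochhammer_negn n k : (k <= n)%N ->
  pochhammer (- n%:R : R[i]) k = (-1) ^+ k * n`!%:R / (n - k)`!%:R.
Proof.
elim: k => [|k ih] kn.
  by rewrite pochhammer0 mul1r subn0 divff// pnatr_eq0 -lt0n fact_gt0.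
rewrite pochhammerS ih 1?ltnW// [in RHS]exprS.
rewrite -(subnSK kn) factS natrM.
have -> : - n%:R + k%:R = - (n - k.+1).+1%:R :> R[i].
  by rewrite subnSK// natrB 1?ltnW// opprB addrC.
have : ((n - k.+1)`!%:R : R[i]) != 0 by rewrite pnatr_eq0 -lt0n fact_gt0.
have : ((n - k.+1).+1%:R : R[i]) != 0 by rewrite pnatr_eq0.
by move=> ? ?; field; apply/andP.
Qed.

Lemma pochhammer_negn_eq0 n k : (n < k)%N -> pochhammer (- n%:R : R[i]) k = 0.
Proof.
move=> nk; rewrite -(subnKC nk) pochhammerD pochhammerS addNr mulr0 mul0r.
by [].
Qed.

Lemma pochhammer_half_neq0 n : pochhammer (3 / 2 : R[i]) n != 0.
Proof.
apply/prodf_neq0 => i _; by rewrite gt_eqF.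
Qed.

(** Since [(3/2)_n / (3/2)_k = (3/2 + k)_(n - k)], this is what remains of the
    [k]-th term of [i ^ n f_n] once the factor [(b)_k * 2 ^ k / k!] that depends
    on the argument is removed. *)
Definition mp_coef n k : R[i] :=
  if (k <= n)%N then
    (-1) ^+ (n - k) * pochhammer (3 / 2 + k%:R) (n - k) / (n - k)`!%:R
  else 0.

(** [i ^ n f_n(x)] as a polynomial in [b = 3/4 + i x]. *)
Definition mp_poly b n : R[i] :=
  \sum_(k < n.+1) mp_coef n k * (pochhammer b k * 2 ^+ k / k`!%:R).

(** The partial sums of the defining series are constant from [n + 1] on. *)
Lemma hyp2F1_negn n b c z : hyp2F1 (- n%:R) b c z =
  \sum_(k < n.+1) pochhammer (- n%:R) k * pochhammer b k / pochhammer c k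
     * z ^+ k / k`!%:R :> R[i].
Proof.
rewrite /hyp2F1; apply: (@cvg_lim R[i]^o); first exact: norm_hausdorff.
rewrite -(cvg_shiftn n.+1) [X in X @ _ --> _](_ : _ = cst
  (\sum_(k < n.+1) pochhammer (- n%:R) k * pochhammer b k / pochhammer c k
     * z ^+ k / k`!%:R)); first exact: cvg_cst.
apply/funext => m /=; rewrite /series /= addnC.
rewrite (big_cat_nat _ (n := n.+1)) ?leq_addr//=.
rewrite big_mkord [X in _ + X]big_nat_cond [X in _ + X]big1 ?addr0//.
by move=> k /andP[/andP[nk _] _]; rewrite pochhammer_negn_eq0// !mul0r.
Qed.

Lemma poly_f_mp n x :
  'i ^+ n * poly_f n x = mp_poly (3 / 4 + 'i * x) n.
Proof.
rewrite /poly_f hyp2F1_negn /mp_poly mulrA mulr_sumr; apply: eq_bigr => k _.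
have kn : (k <= n)%N by rewrite -ltnS.
rewrite /mp_coef kn pochhammer_negn//.
have -> : pochhammer (3 / 2 : R[i]) n =
    pochhammer (3 / 2) k * pochhammer (3 / 2 + k%:R) (n - k).
  by rewrite -pochhammerD subnKC.
have i2 : 'i ^+ n * 'i ^+ n = (-1) ^+ (n - k) * (-1) ^+ k :> R[i].
  by rewrite -exprMn -expr2 sqrCi -exprD subnK.
have e : ((-1) ^+ k * (-1) ^+ k = 1 :> R[i]) by rewrite -exprMn mulrNN mulr1 expr1n.
have := pochhammer_half_neq0 k.
have : (n`!%:R : R[i]) != 0 by rewrite pnatr_eq0 -lt0n fact_gt0.
have : (k`!%:R : R[i]) != 0 by rewrite pnatr_eq0 -lt0n fact_gt0.
have : ((n - k)`!%:R : R[i]) != 0 by rewrite pnatr_eq0 -lt0n fact_gt0.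
move: (n - k)`!%:R k`!%:R n`!%:R => u v w u0 v0 w0 p0.
transitivity (('i ^+ n * 'i ^+ n * (-1) ^+ k) *
   (pochhammer (3 / 2 + k%:R) (n - k) / u *
    (pochhammer (3 / 4 + 'i * x) k * 2 ^+ k / v))).
  by field; rewrite p0 u0 v0 w0.
rewrite i2 -[_ * _ * (-1) ^+ k]mulrA e mulr1.
by field; rewrite u0 v0.
Qed.

Lemma pochhammer1D (j m : nat) : pochhammer (3 / 2 + j%:R : R[i]) m.+1 =
  (3 / 2 + j%:R) * pochhammer (3 / 2 + j.+1%:R) m.
Proof.
by rewrite -[m.+1]add1n pochhammerD pochhammerS pochhammer0 mul1r addr0 -(natr1 j) addrA.
Qed.

(** Removing the common factor [(3/2 + k)_(n - k)] and the factorials leaves an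
    identity between polynomials in [n] and [k]; the two largest values of [k],
    for which a coefficient on the right vanishes, and [k = 0], which has no
    predecessor, are done apart. *)
Lemma mp_coef_rec n k :
  n.+2%:R * mp_coef n.+2 k = k%:R * mp_coef n.+1 k.-1
    - (2 * k%:R + 3 / 2) * mp_coef n.+1 k + (n%:R + 3 / 2) * mp_coef n k.
Proof.
have [kn|nk] := leqP k n; last first.
  rewrite [mp_coef n k]/mp_coef leqNgt nk mulr0 addr0.
  case: k nk => // k; rewrite ltnS leq_eqVlt => /predU1P[<-|].
    rewrite /mp_coef/= ?ltnSn ?leqnSn ?leqnn ?subSnn ?subnn.
    rewrite !pochhammerS !pochhammer0 !fact0 -!natr1.
    by field.
  rewrite leq_eqVlt => /predU1P[<-|nk].
    rewrite /mp_coef/= ?ltnSn ?leqnn ?ltnn ?subnn ?pochhammer0 -!natr1.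
    by field.
  have [k2 [k1 k0]] : (k.+1 <= n.+2)%N = false /\ (k <= n.+1)%N = false /\
      (k.+1 <= n.+1)%N = false.
    by split; [|split]; apply/negbTE; rewrite -ltnNge// ltnW.
  by rewrite /mp_coef/= k2 k1 k0 !mulr0 subrr.
move: (subnKC kn); move: (n - k)%N => m <- {n kn}.
case: k => [|j].
  rewrite !mul0r !add0n /mp_coef !leq0n !subn0 !pochhammerS !factS.
  rewrite !exprS !natrM -!natr1.
  have : (m`!%:R : R[i]) != 0 by rewrite pnatr_eq0 -lt0n fact_gt0.
  have : (m%:R + 1 : R[i]) != 0 by rewrite natr1 pnatr_eq0.
  have : (m%:R + 1 + 1 : R[i]) != 0 by rewrite !natr1 pnatr_eq0.
  by move=> ? ? ?; field; do ?[apply/andP; split].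
have l0 : (j.+1 <= j.+1 + m)%N by rewrite leq_addr.
have l1 : (j.+1 <= (j.+1 + m).+1)%N by rewrite leqW.
have l2 : (j.+1 <= (j.+1 + m).+2)%N by rewrite leqW.
have l3 : (j <= (j.+1 + m).+1)%N by rewrite ltnW.
rewrite /mp_coef [j.+1.-1]/= l0 l1 l2 l3.
have -> : ((j.+1 + m).+2 - j.+1 = m.+2)%N by rewrite -addnS -addnS addKn.
have -> : ((j.+1 + m).+1 - j = m.+2)%N by rewrite addSn -addnS -addnS addKn.
have -> : ((j.+1 + m).+1 - j.+1 = m.+1)%N by rewrite -addnS addKn.
have -> : (j.+1 + m - j.+1 = m)%N by rewrite addKn.
have nE p : p.+1%:R = p%:R + 1 :> R[i] by rewrite natr1.
rewrite (pochhammer1D j m.+1) !pochhammerS !factS !exprS !natrM.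
rewrite !(nE (j.+1 + m).+1, nE (j.+1 + m)%N, natrD, nE m.+1, nE m, nE j).
have : (m`!%:R : R[i]) != 0 by rewrite pnatr_eq0 -lt0n fact_gt0.
have : (m%:R + 1 : R[i]) != 0 by rewrite natr1 pnatr_eq0.
have : (m%:R + 1 + 1 : R[i]) != 0 by rewrite !natr1 pnatr_eq0.
by move=> ? ? ?; field; do ?[apply/andP; split].
Qed.

(** With [e_k = (b)_k * 2 ^ k / k!], the relation
    [(k + 1) e_(k + 1) = 2 (b + k) e_k] absorbs the shifted term of
    [mp_coef_rec] and produces the factor [2 b]. *)
Lemma mp_poly_rec b n :
  n.+2%:R * mp_poly b n.+2 =
  (2 * b - 3 / 2) * mp_poly b n.+1 + (n%:R + 3 / 2) * mp_poly b n.
Proof.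
pose e k : R[i] := pochhammer b k * 2 ^+ k / k`!%:R.
have mpE m N : (m < N)%N -> mp_poly b m = \sum_(k < N) mp_coef m k * e k.
  move=> mN; rewrite /mp_poly -!(big_mkord xpredT (fun k => mp_coef m k * e k)).
  rewrite [RHS](big_cat_nat _ (n := m.+1))//=.
  rewrite [X in _ = _ + X]big_nat_cond [X in _ = _ + X]big1 ?addr0//.
  by move=> k /andP[/andP[mk _] _]; rewrite /mp_coef leqNgt mk mul0r.
have eS k : k.+1%:R * e k.+1 = 2 * (b + k%:R) * e k.
  rewrite /e pochhammerS factS natrM exprS.
  have : (k`!%:R : R[i]) != 0 by rewrite pnatr_eq0 -lt0n fact_gt0.
  have : (k.+1%:R : R[i]) != 0 by rewrite pnatr_eq0.
  by move=> ? ?; field; apply/andP.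
have shift : \sum_(k < n.+3) k%:R * mp_coef n.+1 k.-1 * e k =
    \sum_(k < n.+3) 2 * (b + k%:R) * mp_coef n.+1 k * e k.
  rewrite big_ord_recl !mul0r add0r [RHS]big_ord_recr/= [mp_coef _ n.+2]/mp_coef.
  rewrite ltnn mulr0 mul0r addr0; apply: eq_bigr => k _.
  by rewrite mulrAC -[bump 0 k]/k.+1 eS/=; ring.
rewrite (mpE n n.+3 (ltnW (ltnW (ltnSn _)))) (mpE n.+1 n.+3 (ltnW (ltnSn _))).
rewrite (mpE n.+2 n.+3 (ltnSn _)) !mulr_sumr.
rewrite (eq_bigr (fun k : 'I_n.+3 => k%:R * mp_coef n.+1 k.-1 * e k +
  (- (2 * k%:R + 3 / 2) * mp_coef n.+1 k +
   (n%:R + 3 / 2) * mp_coef n k) * e k)); last first.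
  by move=> k _; rewrite mulrA mp_coef_rec; ring.
rewrite big_split/= shift -!big_split/=; apply: eq_bigr => k _.
by ring.
Qed.

Lemma mp_poly0 b : mp_poly b 0 = 1.
Proof.
rewrite /mp_poly big_ord1 /mp_coef /= subnn !pochhammer0 !fact0 !expr0.
by rewrite !divr1 !mulr1.
Qed.

Lemma mp_poly1 b : mp_poly b 1 = 2 * b - 3 / 2.
Proof.
rewrite /mp_poly big_ord_recl big_ord1 /mp_coef /= subnn !pochhammerS !pochhammer0 subn0 /bump leqnn.
by rewrite !fact0 (factS 0) fact0 !expr1; field.
Qed.
End MeixnerPollaczek.

(** * Power series and the generating function *)

Section PowerSeries.
Context {R : realType}.
Implicit Types (a : nat -> R[i]) (K C w : R).

(** The binomial coefficient [(K)_n / n!], the [n]-th Taylor coefficient of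
    [(1 - x) ^ (- K)]. *)
Definition growth K n : R := \prod_(k < n) ((K + k%:R) / k.+1%:R).

Lemma growth_ge0 K n : 0 <= K -> 0 <= growth K n.
Proof. by move=> K0; apply: prodr_ge0 => k _; rewrite divr_ge0// addr_ge0. Qed.

Lemma growthS K n : n.+1%:R * growth K n.+1 = (K + n%:R) * growth K n.
Proof.
rewrite /growth big_ord_recr/= -/(growth K n).
have : (n.+1%:R : R) != 0 by rewrite pnatr_eq0.
by move: n.+1%:R => z ?; field.
Qed.

(** The derivative of [(1 - x) ^ (- K)] is [K (1 - x) ^ (- (K + 1))], so this
    family of majorants is stable under term by term differentiation. *)
Lemma growth_diffs K n : n.+1%:R * growth K n.+1 = K * growth (K + 1) n.
Proof.
rewrite growthS; elim: n => [|n ih]; first by rewrite /growth !big_ord0 addr0.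
have n0 : (n.+1%:R : R) != 0 by rewrite pnatr_eq0.
apply: (mulfI n0); rewrite mulrCA growthS ih [RHS]mulrCA growthS -natr1.
ring.
Qed.

Lemma growth_le K n : 1 <= K -> growth K n <= growth K n.+1.
Proof.
move=> K1; have n0 : 0 < (n.+1%:R : R) by rewrite ltr0n.
rewrite -(ler_pM2l n0) growthS ler_wpM2r ?growth_ge0 ?(le_trans ler01)//.
by rewrite -natr1 addrC lerD2r.
Qed.

(** The ratio of consecutive terms is [w * (K + n) / (n + 1)], which is below
    [q = (1 + w) / 2] for [n] large; the series is then dominated by a
    geometric one. *)
Lemma is_cvg_growth K w : 0 <= K -> 0 <= w -> w < 1 ->
  cvgn (series (fun n => growth K n * w ^+ n)).
Proof.
move=> K0 w0 w1; pose q := (1 + w) / 2.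
have [q0 [q1 wq]] : 0 < q /\ q < 1 /\ w < q by rewrite /q; split; [|split]; lra.
pose N := Num.truncn (K / (q - w)).
have HN n : (N < n)%N -> w * (K + n%:R) <= q * n.+1%:R.
  move=> Nn; have : K / (q - w) <= n%:R.
    by rewrite (le_trans (ltW (truncnS_gt _)))// ler_nat.
  rewrite ler_pdivrMr ?subr_gt0// -natr1 => h.
  have : w * K <= K by rewrite ler_piMl// ltW.
  by nra.
pose u n : R := growth K n * w ^+ n.
have u0 n : 0 <= u n by rewrite mulr_ge0 ?growth_ge0 ?exprn_ge0.
(* [C] is large enough for the bound [C * q ^ n] to hold for the first
   [N + 2] terms, and the ratio bound propagates it to the others. *)
pose C := \sum_(j < N.+2) u j / q ^+ j.
apply: (series_le_cvg (v_ := fun n => C * q ^+ n)) => //.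
- move=> n; rewrite mulr_ge0//; last by rewrite exprn_ge0 ?ltW.
  by rewrite sumr_ge0// => j _; rewrite divr_ge0// exprn_ge0// ltW.
- have Cn n : (n < N.+2)%N -> u n <= C * q ^+ n.
    move=> nN; rewrite -ler_pdivrMr ?exprn_gt0//.
    rewrite /C (bigD1 (Ordinal nN))//= lerDl.
    by rewrite sumr_ge0// => j _; rewrite divr_ge0// exprn_ge0// ltW.
  elim=> [|n ih]; first exact: Cn.
  have [nN|Nn] := leqP n N; first exact: Cn.
  rewrite [q ^+ _]exprS mulrCA (le_trans _ (ler_wpM2l (ltW q0) ih))//.
  have n0 : 0 < (n.+1%:R : R) by rewrite ltr0n.
  rewrite -(ler_pM2l n0) exprS.
  rewrite (_ : _ * (_ * (w * _)) = w * (K + n%:R) * u n); last first.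
    by rewrite mulrA growthS /u; ring.
  by rewrite mulrA [_ * q]mulrC; apply: ler_wpM2r; [exact: u0|exact: HN].
- by apply: is_cvg_geometric_series; rewrite gtr0_norm.
Qed.

(** Domination by the Taylor coefficients of some [C (1 - x) ^ (- K)].  It
    ensures convergence on [-1 < w < 1] and is inherited by the derivative. *)
Definition tame a := exists2 K, 0 <= K &
  exists2 C, 0 <= C & forall n, normc (a n) <= C * growth K n.

Definition cdiffs a n : R[i] := n.+1%:R * a n.+1.

Lemma tame_cdiffs a : tame a -> tame (cdiffs a).
Proof.
move=> [K K0 [C C0 aC]]; exists (K + 1); first by rewrite addr_ge0.
exists (C * K); first exact: mulr_ge0.
move=> n; rewrite /cdiffs normcM -(rmorph_nat (real_complex R)) normc_real ger0_norm//.
by rewrite -mulrA -growth_diffs mulrCA ler_wpM2l.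
Qed.

Lemma tame_cvg a w : tame a -> `|w| < 1 ->
  cvgn (pseries (fun n => complex.Re (a n)) w) /\
  cvgn (pseries (fun n => complex.Im (a n)) w).
Proof.
move=> [K K0 [C C0 aC]] w1.
have cv : cvgn (series (fun n => C * (growth K n * `|w| ^+ n))).
  by apply: is_cvg_seriesZ; exact: is_cvg_growth.
split; apply: normed_cvg; apply: series_le_cvg cv => //= n.
- by rewrite mulr_ge0// mulr_ge0 ?growth_ge0 ?exprn_ge0.
- rewrite mulrA normrM normrX ler_wpM2r ?exprn_ge0//.
  exact: le_trans (Re_le_normc _) _.
- by rewrite mulr_ge0// mulr_ge0 ?growth_ge0 ?exprn_ge0.
- rewrite mulrA normrM normrX ler_wpM2r ?exprn_ge0//.
  exact: le_trans (Im_le_normc _) _.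
Qed.

Definition cpsum a w N : R[i] := \sum_(k < N) a k * w%:C ^+ k.

Lemma cpsumS a w N : cpsum a w N.+1 = cpsum a w N + a N * w%:C ^+ N.
Proof. by rewrite /cpsum big_ord_recr. Qed.

Lemma Re_cpsum a w N :
  complex.Re (cpsum a w N) = pseries (fun n => complex.Re (a n)) w N.
Proof.
rewrite /cpsum Re_cplx_sum /pseries /series/= big_mkord; apply: eq_bigr => k _.
by rewrite -rmorphXn mulrC Re_real_cplxM mulrC.
Qed.

Lemma Im_cpsum a w N :
  complex.Im (cpsum a w N) = pseries (fun n => complex.Im (a n)) w N.
Proof.
rewrite /cpsum Im_cplx_sum /pseries /series/= big_mkord; apply: eq_bigr => k _.
by rewrite -rmorphXn mulrC Im_real_cplxM mulrC.
Qed.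

Definition psum a w : R[i] :=
  limn (pseries (fun n => complex.Re (a n)) w) +i*
  limn (pseries (fun n => complex.Im (a n)) w).

Lemma cvg_cpsum a w : tame a -> `|w| < 1 ->
  (cpsum a w : nat -> R[i]^o) @ \oo --> (psum a w : R[i]^o).
Proof.
move=> ta w1; have [cR cI] := tame_cvg ta w1; apply: cvg_cplx.
  by under eq_fun do rewrite Re_cpsum.
by under eq_fun do rewrite Im_cpsum.
Qed.

(** The derivatives of all orders of a tame series converge at a point [v]
    between [|w|] and [1], which allows term by term differentiation. *)
Lemma is_cderive_psum a w : tame a -> `|w| < 1 ->
  is_cderive w (psum a) (psum (cdiffs a) w).
Proof.
move=> ta w1; pose v := (1 + `|w|) / 2.
have wv : `|w| < `|v|.
  by rewrite [`|v|]ger0_norm /v; have := normr_ge0 w; lra.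
have v1 : `|v| < 1.
  by rewrite [`|v|]ger0_norm /v; have := normr_ge0 w; lra.
have [aR aI] := tame_cvg ta v1.
have [bR bI] := tame_cvg (tame_cdiffs ta) v1.
have [cR cI] := tame_cvg (tame_cdiffs (tame_cdiffs ta)) v1.
have RE b : (fun n => complex.Re (cdiffs b n)) =
    pseries_diffs (fun n => complex.Re (b n)).
  apply/funext => n; rewrite /cdiffs -(rmorph_nat (real_complex R)).
  exact: Re_real_cplxM.
have IE b : (fun n => complex.Im (cdiffs b n)) =
    pseries_diffs (fun n => complex.Im (b n)).
  apply/funext => n; rewrite /cdiffs -(rmorph_nat (real_complex R)).
  exact: Im_real_cplxM.
rewrite !RE in bR cR; rewrite !IE in bI cI.
split; rewrite /= ?RE ?IE.
  exact: pseries_snd_diffs wv.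
exact: pseries_snd_diffs wv.
Qed.
End PowerSeries.

Section GeneratingFunction.
Context {R : realType}.
Implicit Types (b : R[i]) (w : R).

(** Induction on two consecutive terms: as [growth K] is nondecreasing, the
    recurrence bounds [(n + 2) |a_(n + 2)|] by
    [(|2 b - 3/2| + n + 3/2) * growth K (n + 1)], and
    [K = 1 + |2 b - 3/2|] makes this at most
    [(K + n + 1) * growth K (n + 1) = (n + 2) * growth K (n + 2)]. *)
Lemma mp_poly_growth b n :
  normc (mp_poly b n) <= growth (1 + normc (2 * b - 3 / 2)) n.
Proof.
set M := normc (2 * b - 3 / 2); set K := 1 + M.
have M0 : 0 <= M by exact: normc_ge0.
have K1 : 1 <= K by rewrite lerDl.
suff : normc (mp_poly b n) <= growth K n /\
    normc (mp_poly b n.+1) <= growth K n.+1 by case.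
elim: n => [|n [ih1 ih2]].
  rewrite mp_poly0 mp_poly1 /growth big_ord0 big_ord1 addr0 divr1 normc1.
  by split; rewrite // lerDr.
split=> //; have n0 : 0 < (n.+2%:R : R) by rewrite ltr0n.
rewrite -(ler_pM2l n0) growthS.
have -> : n.+2%:R * normc (mp_poly b n.+2) = normc (n.+2%:R * mp_poly b n.+2).
  by rewrite normcM -(rmorph_nat (real_complex R)) normc_real ger0_norm.
rewrite mp_poly_rec (le_trans (le_normcD _ _))// !normcM -/M.
have -> : normc (n%:R + 3 / 2 : R[i]) = n%:R + 3 / 2.
  have -> : n%:R + 3 / 2 = (n%:R + 3 / 2 : R)%:C.
    by rewrite rmorphD rmorphM fmorphV !rmorph_nat.
  by rewrite normc_real ger0_norm// addr_ge0// divr_ge0.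
have c0 : 0 <= n%:R + 3 / 2 :> R by rewrite addr_ge0// divr_ge0.
have h1 := ler_wpM2l M0 ih2.
have h2 := ler_wpM2l c0 (le_trans ih1 (growth_le n K1)).
have h3 := growth_ge0 n.+1 (le_trans ler01 K1).
rewrite (le_trans (lerD h1 h2))// -mulrDl ler_wpM2r// /K -natr1.
by lra.
Qed.

Lemma tame_mp_poly b : tame (mp_poly b).
Proof.
exists (1 + normc (2 * b - 3 / 2)); first by rewrite addr_ge0 ?normc_ge0.
by exists 1 => // n; rewrite mul1r mp_poly_growth.
Qed.

(** The recurrence summed up to a finite order: the differential equation of
    the generating series, without any convergence argument. *)
Lemma mp_cpsum_ode b w N :
  cpsum (cdiffs (mp_poly b)) w N.+2 =
  (2 * b - 3 / 2) * cpsum (mp_poly b) w N.+2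
  + 3 / 2 * w%:C * cpsum (mp_poly b) w N.+1
  + w%:C ^+ 2 * cpsum (cdiffs (mp_poly b)) w N.
Proof.
elim: N => [|N ih].
  rewrite /cpsum !big_ord_recr !big_ord0 /= /cdiffs mp_poly_rec mp_poly1 mp_poly0.
  by field.
rewrite cpsumS ih (cpsumS (mp_poly b) _ N.+2) (cpsumS (mp_poly b) _ N.+1).
rewrite (cpsumS (cdiffs (mp_poly b)) _ N) {2}/cdiffs mp_poly_rec [in RHS]/cdiffs.
rewrite -(natr1 N) !exprS.
move: (cpsum _ _ N.+1) (cpsum _ _ N) (mp_poly b N.+2) (mp_poly b N.+1).
by move=> A D u v; ring.
Qed.

Lemma mp_psum_ode b w : `|w| < 1 ->
  (1 - w%:C ^+ 2) * psum (cdiffs (mp_poly b)) w =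
  (2 * b - 3 / 2 + 3 / 2 * w%:C) * psum (mp_poly b) w.
Proof.
move=> w1; have ca := cvg_cpsum (tame_mp_poly b) w1.
have cd := cvg_cpsum (tame_cdiffs (tame_mp_poly b)) w1.
have cMr (z : R[i]^o) (u : nat -> R[i]^o) (l : R[i]^o) : u @ \oo --> l ->
    (fun n => z * u n) @ \oo --> (z * l).
  by move=> ul; exact: (@cvgMr _ _ _ _ _ z).
have shift (u : nat -> R[i]^o) (l : R[i]^o) m : u @ \oo --> l ->
    (fun n => u (n + m)%N) @ \oo --> l.
  by rewrite (cvg_shiftn m).
have lhs : (fun n => (2 * b - 3 / 2) * cpsum (mp_poly b) w (n + 2)
      + 3 / 2 * w%:C * cpsum (mp_poly b) w (n + 1)
      + w%:C ^+ 2 * cpsum (cdiffs (mp_poly b)) w n : R[i]^o) @ \oo -->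
    (psum (cdiffs (mp_poly b)) w : R[i]^o).
  rewrite [X in X @ _ --> _](_ : _ =
      fun n => cpsum (cdiffs (mp_poly b)) w (n + 2)).
    exact: shift.
  by apply/funext => n; rewrite addn2 addn1 mp_cpsum_ode.
have rhs : (fun n => (2 * b - 3 / 2) * cpsum (mp_poly b) w (n + 2)
      + 3 / 2 * w%:C * cpsum (mp_poly b) w (n + 1)
      + w%:C ^+ 2 * cpsum (cdiffs (mp_poly b)) w n : R[i]^o) @ \oo -->
    ((2 * b - 3 / 2) * psum (mp_poly b) w + 3 / 2 * w%:C * psum (mp_poly b) w
      + w%:C ^+ 2 * psum (cdiffs (mp_poly b)) w : R[i]^o).
  apply: cvgD; last exact: cMr.
  by apply: cvgD; apply: cMr; apply: shift.
have E := cvg_unique (@norm_hausdorff _ R[i]^o) lhs rhs.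
rewrite mulrBl mul1r {1}E.
ring.
Qed.

(** The mean value theorem is applied on [[0, 1]] to [y |-> f (w * y)], which
    treats both signs of [w] at once. *)
Lemma is_cderive0_cst (f : R -> R[i]) w : `|w| < 1 ->
  (forall v, `|v| < 1 -> is_cderive v f 0) -> f w = f 0.
Proof.
move=> w1 f0.
have in1 y : y \in `[(0 : R), 1] -> `|w * y| < 1.
  rewrite in_itv/= => /andP[y0 y1]; rewrite normrM (ger0_norm y0).
  by rewrite (le_lt_trans _ w1)// ler_piMr.
have cst (g : R -> R) : (forall v, `|v| < 1 -> is_derive v (1 : R) g 0) ->
    g w = g 0.
  move=> g0; pose h y := g (w * y).
  have hd y : y \in `[(0 : R), 1] -> is_derive y (1 : R) h 0.
    move=> /in1 y1; rewrite -(mul0r w).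
    apply: (@is_derive1_comp _ g (fun y => w * y)); first exact: g0.
    by apply: is_derive_eq; rewrite /GRing.scale/= mulr1.
  have hd' y : y \in `](0 : R), 1[ -> is_derive y (1 : R) h ((fun=> 0) y).
    move=> y01; apply: hd; rewrite in_itv/=; move: y01; rewrite in_itv/=.
    by move=> /andP[/ltW -> /ltW ->].
  have hc : {within `[(0 : R), 1], continuous h}.
    by apply: derivable_within_continuous => y /hd hy; exact: ex_derive.
  have [c _] := MVT ltr01 hd' hc.
  by rewrite mul0r /h mulr1 mulr0 => /eqP; rewrite subr_eq0 => /eqP.
by apply: eq_cplx; apply: (cst (fun y => _ (f y))) => v /f0[].
Qed.

Lemma psum0 (a : nat -> R[i]) : psum a 0 = a 0%N.
Proof.
have lim0 (u : nat -> R) : limn (pseries u 0) = u 0%N.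
  apply: cvg_lim => //; rewrite -cvg_shiftS.
  rewrite [X in X @ _ --> _](_ : _ = cst (u 0%N)); first exact: cvg_cst.
  apply/funext => n; rewrite /pseries /series/= big_nat_recl//= expr0 mulr1.
  by rewrite big1 ?addr0// => k _; rewrite expr0n mulr0.
by apply: eq_cplx; rewrite /= lim0.
Qed.

(** The quotient of the two sides has derivative zero by [mp_psum_ode] and
    equals [1] at the origin. *)
Lemma mp_generating_function b w : `|w| < 1 ->
  psum (mp_poly b) w = cpow (1 + w) (b - 3 / 2) * cpow (1 - w) (- b).
Proof.
move=> w1; pose F v : R[i] := cpow (1 + v) (3 / 2 - b) * cpow (1 - v) b.
have pos (v : R) : `|v| < 1 -> 0 < 1 + v /\ 0 < 1 - v.
  by rewrite ltr_norml => /andP[v1 v2]; split; lra.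
pose H v := psum (mp_poly b) v * F v.
have H1 : H w = 1.
  transitivity (H 0).
    apply: is_cderive0_cst => // v v1; have [p1 p2] := pos _ v1.
    have d1 : is_derive v (1 : R) (fun v => 1 + v) 1.
      by apply: is_derive_eq; rewrite add0r mul1r.
    have d2 : is_derive v (1 : R) (fun v => 1 - v) (- 1).
      by apply: is_derive_eq; rewrite add0r mul1r.
    have dF := is_cderiveM (is_cderive_cpow (3 / 2 - b) d1 p1)
      (is_cderive_cpow b d2 p2).
    move: (is_cderiveM (is_cderive_psum (tame_mp_poly b) v1) dF).
    set Z := (X in is_cderive _ _ X -> _).
    suff -> : Z = 0 by [].
    rewrite {}/Z.
    have ode := mp_psum_ode b v1.
    set P := psum (mp_poly b) v in ode *; set D := psum (cdiffs _) _ in ode *.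
    set X := cpow (1 + v) _; set Y := cpow (1 - v) _.
    rewrite /F -/X -/Y.
    have -> : (1 / (1 + v))%:C = 1 / (1 + v%:C) :> R[i].
      by rewrite fmorph_div rmorphD !rmorph1.
    have -> : (-1 / (1 - v))%:C = -1 / (1 - v%:C) :> R[i].
      by rewrite fmorph_div rmorphB rmorphN !rmorph1.
    have q1 : 1 + v%:C != 0 :> R[i].
      by rewrite -(rmorph1 (real_complex R)) -rmorphD fmorph_eq0 gt_eqF.
    have q2 : 1 - v%:C != 0 :> R[i].
      by rewrite -(rmorph1 (real_complex R)) -rmorphB fmorph_eq0 gt_eqF.
    move: v%:C q1 q2 ode => z q1 q2 ode.
    have -> : D = (2 * b - 3 / 2 + 3 / 2 * z) * P / ((1 + z) * (1 - z)).
      rewrite -ode; field.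
      by rewrite q1 q2.
    by field; rewrite q1 q2.
  by rewrite /H psum0 mp_poly0 /F addr0 subr0 !cpow1 !mul1r.
have [p1 p2] := pos _ w1.
have inv x s : cpow x s * cpow x (- s) = 1 :> R[i].
  by rewrite -cpowD addrN cpow0.
set X := cpow (1 + w) _; set Y := cpow (1 - w) _.
have e : F w * (X * Y) = 1.
  rewrite mulrACA /X -(opprB (3 / 2) b) inv mul1r.
  exact: inv.
by rewrite -[LHS]mulr1 -e mulrA -/(H w) H1 mul1r.
Qed.

End GeneratingFunction.

(** * Continuity and integrability of [omega] *)

Section Mtest.
Context {R : realType}.
Implicit Types (u : nat -> R -> R) (g : nat -> R) (D : set R).

Lemma series_bound_cvg (v g : nat -> R) : (forall n, `|v n| <= g n) ->
  cvgn (series g) -> cvgn (series v).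
Proof.
move=> vg cg; apply: normed_cvg; apply: series_le_cvg cg => // n; first exact: normr_ge0.
exact: le_trans (normr_ge0 _) (vg n).
Qed.

Lemma series_tail_le (v g : nat -> R) N : (forall n, `|v n| <= g n) ->
  cvgn (series g) ->
  `|limn (series v) - series v N| <= limn (series g) - series g N.
Proof.
move=> vg cg; have cv := series_bound_cvg vg cg.
have cd : (fun n => `|series v n - series v N|) @ \oo -->
    `|limn (series v) - series v N|.
  by apply: cvg_norm; apply: cvgB => //; exact: cvg_cst.
rewrite -(cvg_lim _ cd)//; apply: limr_le; first by apply/cvg_ex; eexists; exact: cd.
exists N => // n /= Nn.
rewrite (@le_trans _ _ (series g n - series g N))//.
  rewrite !sub_series_geq//.
  by rewrite (le_trans (ler_norm_sum _ _ _))// ler_sum.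
rewrite lerD2r; apply: nondecreasing_cvgn_le => //.
apply/nondecreasing_seqP => k; rewrite /series/= big_nat_recr//= lerDl.
exact: le_trans (normr_ge0 _) (vg k).
Qed.

(** Weierstrass M-test: the tail bound [series_tail_le] is uniform on [D], and
    the uniform limit of continuous functions is continuous. *)
Lemma Mtest_continuous u g D : open D ->
  (forall n x, D x -> `|u n x| <= g n) -> cvgn (series g) ->
  (forall n x, D x -> {for x, continuous (u n)}) ->
  forall x, D x -> {for x, continuous (fun y => limn (series (u ^~ y)))}.
Proof.
move=> oD ug cg uc x Dx; apply/cvgrPdist_lt => e e0.
have e3 : 0 < e / 3 by rewrite divr_gt0.
have /cvgrPdist_lt /(_ _ e3)[N _ HN] := cg.
have tail y : D y -> `|limn (series (u ^~ y)) - series (u ^~ y) N| < e / 3.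
  move=> Dy; apply: le_lt_trans (series_tail_le N (fun n => ug n _ Dy) cg) _.
  by apply: le_lt_trans (HN N (leqnn N)); rewrite ler_norm.
have sc : {for x, continuous (fun y => series (u ^~ y) N)}.
  rewrite /series/=.
  elim: (index_iota _ _) => [|k s ih].
    rewrite (_ : (fun y => _) = cst 0); first exact: cst_continuous.
    by apply/funext => y; rewrite big_nil.
  rewrite (_ : (fun y => _) = (fun y => u k y + \sum_(j <- s) u j y)).
    by apply: continuousD => //; exact: uc.
  by apply/funext => y; rewrite big_cons.
have /cvgrPdist_lt /(_ _ e3) scx := sc.
have nD : nbhs x D by apply: open_nbhs_nbhs; split.
near=> y.
have Dy : D y by near: y; exact: nD.
have h1 := tail _ Dx; have h2 := tail _ Dy.
have h3 : `|series (u ^~ x) N - series (u ^~ y) N| < e / 3.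
  by near: y; exact: scx.
move: h1 h2 h3.
set a := limn _; set b := limn _; set c := series _ _; set d := series _ _.
move=> h1 h2 h3.
have -> : a - b = (a - c) + ((c - d) + (d - b)) by ring.
rewrite (le_lt_trans (ler_normD _ _))//.
have : `|c - d + (d - b)| <= `|c - d| + `|d - b| by exact: ler_normD.
rewrite (distrC d b).
by lra.
Unshelve. all: by end_near. Qed.

End Mtest.

Lemma nneseries_EFin {R : realType} (h : nat -> R) : cvgn (series h) ->
  (\sum_(n <oo) (h n)%:E = (limn (series h))%:E)%E.
Proof.
move=> ch; rewrite -EFin_lim//; congr (limn _).
by apply/funext => n /=; rewrite sumEFin.
Qed.

Section Omega.
Context {R : realType}.
Notation mu := (@lebesgue_measure R).
Implicit Types (x : R) (n m : nat).

(** [1 / (n + 2) ^ 2 <= 1 / (n + 1) - 1 / (n + 2)] telescopes. *)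
Lemma is_cvg_series_invsq : cvgn (series (fun n => (n.+1%:R ^+ 2)^-1 : R)).
Proof.
have bound n : series (fun n => (n.+1%:R ^+ 2)^-1 : R) n.+1 <= 2 - n.+1%:R^-1.
  elim: n => [|n ih].
    by rewrite /series/= big_nat1 expr1n invr1; lra.
  rewrite /series/= big_nat_recr//= -/(series _ _).
  have : (n.+2%:R ^+ 2)^-1 <= n.+1%:R^-1 - n.+2%:R^-1 :> R.
    have n0 : 0 < n.+1%:R :> R by rewrite ltr0n.
    rewrite -(natr1 n.+1); move: n0; set z := n.+1%:R => z0.
    have -> : z^-1 - (z + 1)^-1 = (z * (z + 1))^-1.
      by field; apply/andP; split; rewrite gt_eqF// addr_gt0.
    rewrite lef_pV2 ?posrE ?mulr_gt0 ?exprn_gt0 ?addr_gt0//.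
    by nra.
  by move=> h; rewrite (le_trans (lerD ih h))// addrA subrK.
apply: nondecreasing_is_cvgn.
  apply/nondecreasing_seqP => k; rewrite /series/= big_nat_recr//= lerDl.
  by rewrite invr_ge0 exprn_ge0.
exists 2 => _ [[|n] _ <-]; first by rewrite /series/= big_nil.
by rewrite (le_trans (bound n))// gerBl invr_ge0.
Qed.

(** The term of index [m = n + 1] in the series of [omega]. *)
Definition omega_term n x : R :=
  (2 * pi ^+ 2 * n.+1%:R ^+ 4 * x ^+ 2 - 3 * pi * n.+1%:R ^+ 2 * x)
      * expR (- (pi * n.+1%:R ^+ 2 * x)).

(** With [y = pi * m ^ 2 * x], the term is [(2 y ^ 2 - 3 y) * exp (- y)].  The
    polynomial factor is at most [38 exp (y / 2)], because
    [exp (y / 2) >= (1 + y / 4) ^ 2], and [exp (- y / 2) <= exp (- m ^ 2 x)],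
    because [pi >= 2]. *)
Lemma omega_term_le n x : 0 < x ->
  `|omega_term n x| <= 38 * expR (- n.+1%:R ^+ 2 * x).
Proof.
move=> x0; rewrite /omega_term.
set q := n.+1%:R ^+ 2; have q0 : 0 < q by rewrite exprn_gt0// ltr0n.
have -> : n.+1%:R ^+ 4 = q ^+ 2 :> R by rewrite /q -exprM.
set y := pi * q * x.
have y0 : 0 < y by rewrite !mulr_gt0// pi_gt0.
have -> : 2 * pi ^+ 2 * q ^+ 2 * x ^+ 2 - 3 * pi * q * x = 2 * y ^+ 2 - 3 * y.
  by rewrite /y; ring.
have qy : q * x <= y / 2.
  by rewrite ler_pdivlMr// /y mulrC mulrA ler_wpM2r ?ler_wpM2r ?pi_ge2// ltW.
have ey : 1 + y / 4 <= expR (y / 4) by exact: expR_ge1Dx.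
have e2 : expR (y / 2) = expR (y / 4) ^+ 2.
  by rewrite expr2 -expRD; congr expR; field.
have ee : expR (- y) = expR (- (y / 2)) * expR (- (y / 2)).
  by rewrite -expRD; congr expR; field.
have e2i : expR (y / 2) * expR (- (y / 2)) = 1 by rewrite -expRD subrr expR0.
have bd : `|2 * y ^+ 2 - 3 * y| <= 38 * expR (y / 2).
  rewrite e2; have : (1 + y / 4) ^+ 2 <= expR (y / 4) ^+ 2.
    by rewrite lerXn2r// nnegrE ?expR_ge0// addr_ge0// divr_ge0// ltW.
  by rewrite ler_norml => h; apply/andP; split; nra.
rewrite normrM (ger0_norm (expR_ge0 _)) ee mulrA.
apply: ler_pM.
- by rewrite mulr_ge0 ?expR_ge0.
- by rewrite expR_ge0.
- rewrite [leRHS](_ : _ = 38 * expR (y / 2) * expR (- (y / 2))).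
    by rewrite ler_wpM2r// expR_ge0.
  by rewrite -mulrA e2i mulr1.
- by rewrite ler_expR mulNr lerN2.
Qed.

(** [exp (- z) <= 1 / z] for [z > 0]. *)
Lemma expR_invsq_le n x : 0 < x ->
  38 * expR (- n.+1%:R ^+ 2 * x) <= 38 / x * (n.+1%:R ^+ 2)^-1.
Proof.
move=> x0.
have q0 : 0 < n.+1%:R ^+ 2 :> R by rewrite exprn_gt0// ltr0n.
rewrite -mulrA ler_wpM2l// -invfM mulNr expRN lef_pV2 ?posrE ?expR_gt0 ?mulr_gt0//.
by rewrite mulrC (le_trans _ (expR_ge1Dx _))// lerDr.
Qed.

Lemma omega_term_invsq n x : 0 < x ->
  `|omega_term n x| <= 38 / x * (n.+1%:R ^+ 2)^-1.
Proof. by move=> x0; apply: le_trans (omega_term_le n x0) (expR_invsq_le n x0). Qed.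

Lemma is_cvg_omega x : 0 < x -> cvgn (series (omega_term ^~ x)).
Proof.
move=> x0; apply: (series_bound_cvg (fun n => omega_term_invsq n x0)).
by apply: is_cvg_seriesZ; exact: is_cvg_series_invsq.
Qed.

Lemma omegaE x : 0 < x -> omega x = limn (series (omega_term ^~ x)).
Proof.
move=> x0; apply: cvg_lim => //; rewrite -cvg_shiftS.
rewrite [X in X @ _ --> _](_ : _ = series (omega_term ^~ x)).
  exact: is_cvg_omega.
by apply/funext => n; rewrite /series/= big_add1.
Qed.

Lemma continuous_omega_term n : continuous (omega_term n).
Proof.
move=> x; apply: differentiable_continuous; apply/derivable1_diffP.
by rewrite /omega_term; apply: ex_derive.
Qed.

(** On the half-line above [x / 2] the terms are bounded by a multiple of
    [1 / m ^ 2]. *)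
Lemma continuous_omega x : 0 < x -> {for x, continuous (@omega R)}.
Proof.
move=> x0; have x20 : 0 < x / 2 by rewrite divr_gt0.
pose D := `]x / 2, +oo[%classic.
have oD : open D by exact: interval_open.
have Dx : D x by rewrite /D/= in_itv/= andbT; lra.
have D0 y : D y -> x / 2 < y by rewrite /D/= in_itv/= andbT.
have nD : nbhs x D by apply: open_nbhs_nbhs; split.
have := @Mtest_continuous _ omega_term
  (fun n => 38 / (x / 2) * (n.+1%:R ^+ 2)^-1) D oD.
move=> /(_ _ _ _ x Dx) H.
rewrite /prop_for /continuous_at omegaE//.
apply: cvg_trans (H _ _ _).
- apply: near_eq_cvg; near=> y.
  rewrite omegaE// (lt_trans x20)// D0//.
  by near: y; exact: nD.
- move=> n y /D0 xy; apply: le_trans (omega_term_invsq n (lt_trans x20 xy)) _.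
  rewrite ler_wpM2r ?invr_ge0 ?exprn_ge0// ler_wpM2l// lef_pV2 ?posrE ?ltW//.
  exact: lt_trans xy.
- by apply: is_cvg_seriesZ; exact: is_cvg_series_invsq.
- by move=> n y _; exact: continuous_omega_term.
Unshelve. all: by end_near. Qed.

(** Up to the factor [a], the integrand is the density of the exponential
    distribution. *)
Lemma integral_expR_le (a : R) : 0 < a ->
  (\int[mu]_(x in `]0%R, +oo[) (expR (- a * x))%:E <= (a^-1)%:E)%E.
Proof.
move=> a0.
have mpdf := @measurable_exponential_pdf R a.
have : (\int[mu]_(x in `]0%R, +oo[) (exponential_pdf a x)%:E <= 1)%E.
  rewrite -(integral_exponential_pdf a0); apply: ge0_subset_integral => //.
  - exact/measurable_EFinP.
  - by move=> x _; rewrite lee_fin exponential_pdf_ge0// ltW.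
have -> : (\int[mu]_(x in `]0%R, +oo[) (exponential_pdf a x)%:E =
    \int[mu]_(x in `]0%R, +oo[) (a%:E * (expR (- a * x))%:E))%E.
  apply: eq_integral => x; rewrite inE/= in_itv/= andbT => x0.
  by rewrite -EFinM exponential_pdfE// ltW.
rewrite ge0_integralZl//; last 2 first.
- apply/measurable_EFinP; apply: measurable_funTS.
  by apply: continuous_measurable_fun => x; apply: differentiable_continuous;
    apply/derivable1_diffP; apply: ex_derive.
- by rewrite lee_fin ltW.
by rewrite -lee_pdivlMl// mule1.
Qed.

(** The majorants [38 exp (- m ^ 2 x)] of the terms have integrals at most
    [38 / m ^ 2], so their sum is integrable by monotone convergence. *)
Lemma integrable_omega : mu.-integrable `]0, +oo[ (EFin \o @omega R).
Proof.
have mo : measurable_fun (`]0, +oo[ : set R) (@omega R).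
  apply: open_continuous_measurable_fun; first exact: interval_open.
  by move=> x; rewrite inE/= in_itv/= andbT; exact: continuous_omega.
apply/integrableP; split; first exact/measurable_EFinP.
pose g n x : R := 38 * expR (- n.+1%:R ^+ 2 * x).
have mg n : measurable_fun (`]0, +oo[ : set R) (g n).
  apply: measurable_funTS.
  by apply: continuous_measurable_fun => x; apply: differentiable_continuous;
    apply/derivable1_diffP; apply: ex_derive.
pose f n x : \bar R := (g n x)%:E.
have mf n : measurable_fun (`]0, +oo[ : set R) (f n) by exact/measurable_EFinP.
have f0 n x : (0 <= f n x)%E by rewrite lee_fin mulr_ge0// expR_ge0.
apply: (@le_lt_trans _ _ (\int[mu]_(x in `]0%R, +oo[) \sum_(n <oo) f n x)%E).
  apply: ge0_le_integral => //.
  - by apply: measurableT_comp => //; exact/measurable_EFinP.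
  - by apply: ge0_emeasurable_sum => *; [exact: f0|exact: mf]. 
  move=> x; rewrite /= in_itv/= andbT => x0; rewrite omegaE//. 
  have cg : cvgn (series (g ^~ x)).
    apply: (series_bound_cvg (g := fun n => 38 / x * (n.+1%:R ^+ 2)^-1)).
      move=> n; rewrite ger0_norm ?mulr_ge0 ?expR_ge0//.
      exact: expR_invsq_le.
    by apply: is_cvg_seriesZ; exact: is_cvg_series_invsq.
  rewrite nneseries_EFin// lee_fin.
  have := @series_tail_le _ (omega_term ^~ x) (g ^~ x) 0
    (fun n => omega_term_le n x0) cg.
  by rewrite /series/= !big_nil !subr0.
rewrite integral_nneseries//.
apply: (@le_lt_trans _ _ (\sum_(n <oo) (38 * (n.+1%:R ^+ 2)^-1)%:E)%E).
  apply: lee_nneseries => [n _ _|n _]; first exact: integral_ge0.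
  have q0 : 0 < n.+1%:R ^+ 2 :> R by rewrite exprn_gt0// ltr0n.
  rewrite /f /g; under eq_integral do rewrite EFinM.
  rewrite ge0_integralZl//; last first.
    apply/measurable_EFinP; apply: measurable_funTS.
    by apply: continuous_measurable_fun => x; apply: differentiable_continuous;
      apply/derivable1_diffP; apply: ex_derive.
  by rewrite EFinM lee_wpmul2l//; exact: integral_expR_le.
have cs : cvgn (series (fun n => 38 * (n.+1%:R ^+ 2)^-1 : R)).
  by apply: is_cvg_seriesZ; exact: is_cvg_series_invsq.
by rewrite nneseries_EFin// ltry.
Qed.

End Omega.

(** * Substitution on the half-line *)

(** On a segment the substitution is the usual one for continuous functions; the
    half-line [x > 0] is exhausted by the segments from [1 / (n + 1)] to [n + 1], and its
    image, the interval from [a] to [b], by their images.  [Finv] serves to see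
    that these images cover the interval. *)
Section Substitution.
Context {R : realType}.
Notation mu := (@lebesgue_measure R).
Variables (F dF Finv : R -> R) (a b : R).
Implicit Types (x y : R).
Hypothesis Fd : forall x : R, 0 < x -> is_derive x (1 : R) F (dF x).
Hypothesis dFc : forall x, 0 < x -> {for x, continuous dF}.
Hypothesis dF0 : forall x, 0 < x -> 0 <= dF x.
Hypothesis Finc : forall x y, 0 < x -> x < y -> F x < F y.
Hypothesis Fab : forall x, 0 < x -> a < F x < b.
Hypothesis FinvK : forall y, a < y < b -> 0 < Finv y /\ F (Finv y) = y.

Let lo n : R := n.+1%:R^-1.
Let hi n : R := n.+1%:R.

Let lo_gt0 n : 0 < lo n. Proof. by rewrite invr_gt0 ltr0n. Qed.
Let lo_le_hi n : lo n <= hi n.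
Proof. by rewrite (@le_trans _ _ 1)// ?ler1n// invf_le1 ?ltr0n// ler1n. Qed.

Let lohi_cover (x : R) : 0 < x -> exists n, lo n <= x <= hi n.
Proof.
move=> x0; exists (maxn (Num.truncn x) (Num.truncn x^-1)); apply/andP; split.
  rewrite /lo -[leRHS]invrK lef_pV2 ?posrE ?invr_gt0// ?ltr0n//.
  by rewrite (le_trans (ltW (truncnS_gt _)))// ler_nat ltnS leq_maxr.
by rewrite (le_trans (ltW (truncnS_gt _)))// ler_nat ltnS leq_maxl.
Qed.

Let Fle x y : 0 < x -> x <= y -> F x <= F y.
Proof.
by move=> x0; rewrite le_eqVlt => /predU1P[->//|xy]; rewrite ltW// Finc.
Qed.

Let dFE x : 0 < x -> derive1 F x = dF x.
Proof. by move=> x0; rewrite derive1E; have [_ ->] := Fd x0. Qed.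

Let Fc x : 0 < x -> {for x, continuous F}.
Proof.
move=> /Fd[Fx _]; apply: differentiable_continuous; exact/derivable1_diffP.
Qed.

Let derivec x : 0 < x -> {for x, continuous (derive1 F)}.
Proof.
move=> x0; rewrite /prop_for /continuous_at dFE//.
apply: cvg_trans (dFc x0); apply: near_eq_cvg.
have : nbhs x [set y | 0 < y] by exact: lt_nbhsr.
by apply: filterS => y /= y0; rewrite dFE.
Qed.

Let substitution_segment (G : R -> R) n :
  (forall y, a < y < b -> {for y, continuous G}) ->
  (\int[mu]_(y in `[F (lo n), F (hi n)]) (G y)%:E =
   \int[mu]_(x in `[lo n, hi n]) (G (F x) * dF x)%:E)%E.
Proof.
move=> Gc.
have gt0 x : lo n <= x -> 0 < x by exact: lt_le_trans.
rewrite (@integration_by_substitution_increasing _ F G (lo n) (hi n))//.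
- apply: eq_integral => x; rewrite inE/= in_itv/= => /andP[/gt0 x0 _].
  by rewrite -(dFE x0).
- move=> x y; rewrite !in_itv/= => /andP[/gt0 x0 _] _; exact: Finc.
- move=> x; rewrite in_itv/= => /andP[/ltW/gt0 x0 _]; exact: derivec.
- apply/cvg_ex; exists (derive1 F (lo n)); apply: cvg_at_right_filter.
  exact: derivec.
- apply/cvg_ex; exists (derive1 F (hi n)); apply: cvg_at_left_filter.
  exact/derivec/gt0.
- split.
  + by move=> x; rewrite in_itv/= => /andP[/ltW/gt0 /Fd[]].
  + by apply: cvg_at_right_filter; exact: Fc.
  + by apply: cvg_at_left_filter; exact/Fc/gt0.
- apply: continuous_in_subspaceT => y; rewrite inE/= in_itv/= => /andP[ly yh].
  apply: Gc; have /andP[al _] := Fab (lo_gt0 n).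
  have /andP[_ hb] := Fab (gt0 _ (lo_le_hi n)).
  by rewrite (lt_le_trans al)//= (le_lt_trans yh).
Qed.

(** Both sides are limits over the exhausting segments, by monotone
    convergence. *)
Lemma ge0_integration_by_substitution_oy (G : R -> R) :
  (forall y, a < y < b -> {for y, continuous G}) ->
  (forall y, a < y < b -> 0 <= G y) ->
  (\int[mu]_(y in `]a, b[) (G y)%:E =
   \int[mu]_(x in `]0%R, +oo[) (G (F x) * dF x)%:E)%E.
Proof.
move=> Gc G0.
have Jsub n y : `[F (lo n), F (hi n)]%classic y -> a < y < b.
  rewrite /= in_itv/= => /andP[ly yh].
  have /andP[al _] := Fab (lo_gt0 n).
  have /andP[_ hb] := Fab (lt_le_trans (lo_gt0 n) (lo_le_hi n)).
  by rewrite (lt_le_trans al)//= (le_lt_trans yh).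
have Esub n x : `[lo n, hi n]%classic x -> 0 < x.
  by rewrite /= in_itv/= => /andP[+ _]; exact: lt_le_trans.
have lole m n : (m <= n)%N -> lo n <= lo m.
  by move=> mn; rewrite lef_pV2 ?posrE ?ltr0n// ler_nat.
have hile m n : (m <= n)%N -> hi m <= hi n by move=> mn; rewrite ler_nat.
have Jcup : \bigcup_n `[F (lo n), F (hi n)]%classic = `]a, b[%classic.
  apply/seteqP; split=> [y [n _ /Jsub]|y]; first by rewrite /= in_itv.
  rewrite /= in_itv/= => /FinvK[x0 <-]; have [n /andP[lx xh]] := lohi_cover x0.
  exists n => //=; rewrite in_itv/= !Fle//.
have Ecup : \bigcup_n `[lo n, hi n]%classic = `]0, +oo[%classic.
  apply/seteqP; split=> [y [n _ /Esub]|y]; first by rewrite /= in_itv/= andbT.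
  rewrite /= in_itv/= andbT => x0; have [n nx] := lohi_cover x0.
  by exists n => //=; rewrite in_itv.
have ndJ : nondecreasing_seq (fun n => `[F (lo n), F (hi n)]%classic).
  move=> m n mn; apply/subsetPset => y /=; rewrite !in_itv/= => /andP[ly yh].
  by rewrite (le_trans _ ly) ?(le_trans yh)// Fle ?lole ?hile.
have ndE : nondecreasing_seq (fun n => `[lo n, hi n]%classic).
  move=> m n mn; apply/subsetPset => y /=; rewrite !in_itv/= => /andP[ly yh].
  by rewrite (le_trans _ ly) ?(le_trans yh) ?lole ?hile.
have mG n : measurable_fun (`[F (lo n), F (hi n)] : set R) (EFin \o G).
  apply/measurable_EFinP; apply: subspace_continuous_measurable_fun => //.
  by apply: continuous_in_subspaceT => y; rewrite inE => /Jsub/Gc.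
have mGF n : measurable_fun (`[lo n, hi n] : set R)
    (EFin \o (fun x => G (F x) * dF x)).
  apply/measurable_EFinP; apply: subspace_continuous_measurable_fun => //.
  apply: continuous_in_subspaceT => x; rewrite inE => /Esub x0.
  apply: continuousM; last exact: dFc.
  apply: continuous_comp; first exact: Fc.
  by apply: Gc; exact: Fab.
have cJ := ge0_nondecreasing_set_cvg_integral (mu := mu) ndJ
  (fun n => measurable_itv _) mG.
have cE := ge0_nondecreasing_set_cvg_integral (mu := mu) ndE
  (fun n => measurable_itv _) mGF.
rewrite Jcup in cJ; rewrite Ecup in cE.
have {}cJ := cJ (fun n y Jy => G0 y (Jsub n y Jy)).
have {}cE := cE (fun n x Ex => mulr_ge0 (G0 _ (Fab (Esub n x Ex))) (dF0 (Esub n x Ex))).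
rewrite -(cvg_lim _ cJ)// -(cvg_lim _ cE)//; congr (limn _); apply/funext => n.
exact: substitution_segment.
Qed.

(** Applied to [|G|], the nonnegative case gives integrability; applied to the
    positive and negative parts of [G], the equality. *)
Lemma integration_by_substitution_oy (G : R -> R) :
  (forall y, a < y < b -> {for y, continuous G}) ->
  mu.-integrable `]0, +oo[ (EFin \o (fun x => G (F x) * dF x)) ->
  mu.-integrable `]a, b[ (EFin \o G) /\
  \int[mu]_(y in `]a, b[) G y = \int[mu]_(x in `]0, +oo[) (G (F x) * dF x).
Proof.
move=> Gc /integrableP[mGF iGF].
have mG : measurable_fun (`]a, b[ : set R) (EFin \o G).
  apply/measurable_EFinP; apply: open_continuous_measurable_fun.
    exact: interval_open.
  by move=> y; rewrite inE/= in_itv/=; exact: Gc.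
have maxc (H : R -> R) y : {for y, continuous H} ->
    {for y, continuous (fun y => Num.max (H y) 0)}.
  by move=> Hc; apply: continuous_max => //; exact: cst_continuous.
split.
  apply/integrableP; split=> //.
  suff e : (\int[mu]_(y in `]a, b[) (`|G y|)%:E = \int[mu]_(x in `]0%R, +oo[)
      `|(EFin \o (fun x => (G (F x) * dF x)%R)) x|)%E.
    by rewrite -e in iGF.
  rewrite (@ge0_integration_by_substitution_oy (fun y => `|G y|))//; last first.
    by move=> y /Gc yc; apply: continuous_comp yc _; exact: norm_continuous.
  apply: eq_integral => x; rewrite inE/= in_itv/= andbT => x0.
  by rewrite normrM (ger0_norm (dF0 x0)).
rewrite /Rintegral integralE [in RHS]integralE; congr (fine (_ - _)%E).
  transitivity (\int[mu]_(y in `]a, b[) (Num.max (G y) 0)%:E)%E.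
    by apply: eq_integral => y _; rewrite funeposE EFin_max.
  rewrite ge0_integration_by_substitution_oy.
  - apply: eq_integral => x; rewrite inE/= in_itv/= andbT => x0.
    by rewrite funeposE -EFin_max maxr_pMl ?mul0r ?dF0.
  - by move=> y /Gc; exact: maxc.
  - by move=> y _; rewrite le_max lexx orbT.
transitivity (\int[mu]_(y in `]a, b[) (Num.max (- G y) 0)%:E)%E.
  by apply: eq_integral => y _; rewrite funenegE EFin_max.
rewrite (@ge0_integration_by_substitution_oy (fun y => Num.max (- G y) 0)).
- apply: eq_integral => x; rewrite inE/= in_itv/= andbT => x0.
  by rewrite funenegE -EFin_max maxr_pMl ?mul0r ?dF0// mulNr.
- move=> y /Gc yc; apply: (maxc (fun y => - G y)).
  exact: continuousN.
- by move=> y _; rewrite le_max lexx orbT.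
Qed.

End Substitution.

(** * Integration term by term *)

Section TermwiseIntegration.
Context d (T : measurableType d) {R : realType}.
Variable mu : {measure set T -> \bar R}.
Implicit Types (D : set T) (W v : T -> R) (c g : nat -> R).

Lemma integrableM_exp D W v n : measurable D ->
  mu.-integrable D (EFin \o W) -> measurable_fun D v ->
  (forall x, D x -> `|v x| <= 1) ->
  mu.-integrable D (EFin \o (fun x => W x * v x ^+ n)).
Proof.
move=> mD iW mv v1; have mW : measurable_fun D W.
  by apply/measurable_EFinP; case/integrableP : iW.
apply: (le_integrable mD _ _ iW).
  apply/measurable_EFinP; apply: measurable_funM => //.
  exact: measurable_funX.
move=> x Dx /=; rewrite lee_fin normrM normrX ler_piMr//.
by rewrite exprn_ile1// v1.
Qed.

(** The partial sums under the integral are dominated by [|W|] times the sum of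
    the [g n]. *)
Lemma cvg_series_Rintegral D W v c g : measurable D ->
  mu.-integrable D (EFin \o W) -> measurable_fun D v ->
  (forall x, D x -> `|v x| <= 1) ->
  (forall n, `|c n| <= g n) -> cvgn (series g) ->
  mu.-integrable D
    (EFin \o (fun x => W x * limn (series (fun n => c n * v x ^+ n)))) /\
  series (fun n => c n * \int[mu]_(x in D) (W x * v x ^+ n)) @ \oo -->
    \int[mu]_(x in D) (W x * limn (series (fun n => c n * v x ^+ n))).
Proof.
move=> mD iW mv v1 cg Sg; have mW : measurable_fun D W.
  by apply/measurable_EFinP; case/integrableP : iW.
have bd x n : D x -> `|c n * v x ^+ n| <= g n.
  move=> Dx; rewrite normrM normrX (le_trans _ (cg n))// ler_piMr//.
  by rewrite exprn_ile1// v1.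
pose G := limn (series g).
pose f n x := W x * series (fun k => c k * v x ^+ k) n.
have mf n : measurable_fun D (EFin \o f n).
  apply/measurable_EFinP; apply: measurable_funM => //.
  apply: measurable_sum => k; apply: measurable_funM => //.
  exact: measurable_funX.
have fcv x : D x -> (EFin \o f ^~ x) n @[n --> \oo] -->
    (W x * limn (series (fun n => c n * v x ^+ n)))%:E.
  move=> Dx; apply: cvg_EFin; first exact: nearW.
  by apply: cvgMr; apply: (series_bound_cvg (g := g)) => // n; exact: bd.
have iG : mu.-integrable D (EFin \o (fun x => `|W x| * G)).
  have := integrableZr mD G (integrable_abse iW).
  by [].
have fG n x : D x -> (`|(EFin \o f n) x| <= (`|W x| * G)%R%:E)%E.
  move=> Dx /=; rewrite lee_fin normrM ler_wpM2l//.
  rewrite (@le_trans _ _ (series g n))//.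
    rewrite /series/= (le_trans (ler_norm_sum _ _ _))// ler_sum// => k _.
    exact: bd.
  apply: nondecreasing_cvgn_le => //.
  apply/nondecreasing_seqP => k; rewrite /series/= big_nat_recr//= lerDl.
  exact: le_trans (normr_ge0 _) (cg k).
have mfl : measurable_fun D
    (fun x => (W x * limn (series (fun n => c n * v x ^+ n)))%:E).
  exact: (emeasurable_fun_cvg (fun n => EFin \o f n) _ mf fcv).
have [ifl _ cvf] := dominated_convergence mD mf mfl
  (aeW mu (fun x Dx => fcv x Dx)) iG (aeW mu (fun x n Dx => fG n x Dx)).
split=> //.
have if_ n : mu.-integrable D (EFin \o f n).
  apply: (le_integrable mD _ _ iG) => // x Dx /=.
  by apply: le_trans (fG n x Dx) _; rewrite lee_fin ler_norm.
have seriesS (h : nat -> R) n : series h n.+1 = series h n + h n.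
  by rewrite /series/= big_nat_recr.
have -> : series (fun n => c n * \int[mu]_(x in D) (W x * v x ^+ n)) =
    (fun n => \int[mu]_(x in D) f n x).
  apply/funext => n; rewrite /f; elim: n => [|n ih].
    rewrite /series/= big_nil; under eq_Rintegral do rewrite big_nil mulr0.
    by rewrite Rintegral_cst// mul0r.
  rewrite seriesS ih.
  rewrite -RintegralZl//; last exact: integrableM_exp.
  rewrite -RintegralD//.
  - by apply: eq_Rintegral => x _; rewrite seriesS mulrDr mulrCA.
  - exact: if_.
  - exact: (integrableZl mD (c n) (integrableM_exp n mD iW mv v1)).
apply: fine_cvg; rewrite fineK; first exact: cvf.
exact: integrable_fin_num.
Qed.

End TermwiseIntegration.

(** * The integrand after substitution *)

Section Kernel.
Context {R : realType}.
Notation mu := (@lebesgue_measure R).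
Implicit Types (r h x y : R) (t : R[i]).

Definition cayley (y : R) : R := (y - 1) / (y + 1).

(** The homography fixing [1] and [-1]; in the [cayley] coordinate it is the
    multiplication by [(1 - h) / (1 + h)], which is [r] for [h = eta r]
    (see [mobius_cayley]). *)
Definition mobius (h y : R) : R := (y + h) / (1 + h * y).

Lemma eta_gt0 r : 0 < r -> r < 1 -> 0 < eta r.
Proof. by move=> r0 r1; rewrite divr_gt0// ?subr_gt0// addr_gt0. Qed.

Lemma eta_lt1 r : 0 < r -> r < 1 -> eta r < 1.
Proof. by move=> r0 r1; rewrite ltr_pdivrMr ?addr_gt0// mul1r; lra. Qed.

Lemma cayley_le1 y : 0 < y -> `|cayley y| <= 1.
Proof.
move=> y0; rewrite ler_norml /cayley ler_pdivlMr ?ler_pdivrMr ?addr_gt0//.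
by apply/andP; split; lra.
Qed.

Lemma norm_r_cayley r y : 0 < r -> r < 1 -> 0 < y -> `|r * cayley y| < 1.
Proof.
move=> r0 r1 y0; rewrite normrM (gtr0_norm r0) (le_lt_trans _ r1)//.
by rewrite ler_piMr ?cayley_le1// ltW.
Qed.

Lemma mobius_cayley r y : 0 < r -> r < 1 -> 0 < y ->
  mobius (eta r) y = (1 + r * cayley y) / (1 - r * cayley y).
Proof.
move=> r0 r1 y0; rewrite /mobius /cayley /eta.
have a0 : y + 1 != 0 by rewrite gt_eqF// addr_gt0.
have b0 : 1 + r != 0 by rewrite gt_eqF// addr_gt0.
have d0 : y + 1 - r * (y - 1) != 0.
  rewrite (_ : _ - _ = 1 + r + (1 - r) * y); last by ring.
  by rewrite gt_eqF// !addr_gt0// mulr_gt0// subr_gt0.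
by field; rewrite a0 b0 d0.
Qed.

Lemma powR32_sqr x : 0 < x -> (x `^ (3 / 2)) ^+ 2 = x ^+ 3.
Proof.
move=> x0; rewrite -!powR_mulrn ?powR_ge0 ?ltW// -powRrM.
by congr (_ `^ _); field.
Qed.

(** Both sides are [((1 + eta) / (1 + eta * y)) ^ (3/2)], the right one because
    [(y + 1) * (1 - r * u) * (1 + eta) = 2 * (1 + eta * y)] with
    [u = cayley y].  They are nonnegative, so it suffices to compare their
    squares, which are rational. *)
Lemma kernel_weight r y : 0 < r -> r < 1 -> 0 < y ->
  (1 + eta r) / Num.sqrt (1 - eta r) *
    (1 / Num.sqrt (1 - eta r * mobius (eta r) y)) *
    ((1 - eta r ^+ 2) / (1 + eta r * y) ^+ 2) =
  2 * Num.sqrt 2 / (y + 1) `^ (3 / 2) / (1 - r * cayley y) `^ (3 / 2).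
Proof.
move=> r0 r1 y0.
have h0 := eta_gt0 r0 r1; have h1 := eta_lt1 r0 r1.
have ry := norm_r_cayley r0 r1 y0.
have p0 : 0 < 1 - r * cayley y by move: ry; rewrite ltr_norml; lra.
have hy : 0 < 1 + eta r * y by rewrite addr_gt0// mulr_gt0.
have y10 : 0 < y + 1 by rewrite addr_gt0.
have q0 : 0 < 1 - eta r by rewrite subr_gt0.
have q1 : 0 < 1 + eta r by rewrite addr_gt0.
have e1 : 1 - eta r * mobius (eta r) y = (1 - eta r ^+ 2) / (1 + eta r * y).
  by rewrite /mobius; field; rewrite gt_eqF.
have q2 : 0 < 1 - eta r ^+ 2.
  by rewrite -[1](expr1n _ 2) subr_sqr mulr_gt0// expr1n.
have e0 : 0 < 1 - eta r * mobius (eta r) y by rewrite e1 divr_gt0.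
have prod : (y + 1) * (1 - r * cayley y) * (1 + eta r) = 2 * (1 + eta r * y).
  rewrite /cayley /eta; field.
  by rewrite !gt_eqF// addr_gt0.
apply: (@pexpIrn _ 2) => //.
- rewrite nnegrE !mulr_ge0// ?invr_ge0 ?sqrtr_ge0 ?exprn_ge0 ?ltW//.
- rewrite nnegrE !mulr_ge0// ?invr_ge0 ?sqrtr_ge0 ?powR_ge0//.
rewrite e1.
have -> : 1 - eta r ^+ 2 = (1 - eta r) * (1 + eta r) by ring.
rewrite !exprMn !exprVn !powR32_sqr// !sqr_sqrtr ?ltW//; last first.
  by rewrite divr_gt0// mulr_gt0.
move: prod; set Y := y + 1 in y10 *; set P := 1 - r * _ in p0 *.
set H := 1 + eta r * y in hy *.
move: q0 q1; set A := 1 - eta r; set B := 1 + eta r => A0 B0 prod.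
have -> : P = 2 * H / (Y * B).
  by rewrite -prod; field; rewrite !gt_eqF.
by field; rewrite !gt_eqF.
Qed.

Lemma mobius_bounds h y : 0 < h -> h < 1 -> 0 < y -> h < mobius h y < h^-1.
Proof.
move=> h0 h1 y0; have hy : 0 < 1 + h * y by rewrite addr_gt0// mulr_gt0.
have hh : 0 < 1 - h ^+ 2 by rewrite subr_gt0 exprn_ilt1// ltW.
rewrite /mobius ltr_pdivlMr// ltr_pdivrMr//; apply/andP; split.
  rewrite -subr_gt0 (_ : _ - _ = y * (1 - h ^+ 2)); last by ring.
  exact: mulr_gt0.
rewrite -subr_gt0 (_ : _ - _ = (1 - h ^+ 2) / h); first exact: divr_gt0.
by field; rewrite gt_eqF.
Qed.

Lemma mobiusK h y : 0 < h -> h < 1 -> 0 < y -> mobius (- h) (mobius h y) = y.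
Proof.
move=> h0 h1 y0; have hy : 0 < 1 + h * y by rewrite addr_gt0// mulr_gt0.
have hh : 0 < 1 - h ^+ 2 by rewrite subr_gt0 exprn_ilt1// ltW.
rewrite /mobius; field; apply/andP; split; first by rewrite gt_eqF.
rewrite (_ : _ + _ = 1 - h ^+ 2); last by ring.
by rewrite gt_eqF.
Qed.

Lemma mobiusNK h x : 0 < h -> h < 1 -> h < x < h^-1 ->
  0 < mobius (- h) x /\ mobius h (mobius (- h) x) = x.
Proof.
move=> h0 h1 /andP[hx xh].
have hh : 0 < 1 - h ^+ 2 by rewrite subr_gt0 exprn_ilt1// ltW.
have hx1 : 0 < 1 - h * x by rewrite subr_gt0 mulrC -ltr_pdivlMr// mul1r.
split; first by rewrite /mobius mulNr divr_gt0// subr_gt0.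
rewrite /mobius mulNr; field; apply/andP; split; first by rewrite gt_eqF.
rewrite (_ : _ + _ = 1 - h ^+ 2); last by ring.
by rewrite gt_eqF.
Qed.

Lemma omega_r_mobius r y : 0 < r -> r < 1 -> 0 < y ->
  omega_r r (mobius (eta r) y) =
  (1 + eta r) / Num.sqrt (1 - eta r) *
    (1 / Num.sqrt (1 - eta r * mobius (eta r) y)) * omega y.
Proof.
move=> r0 r1 y0; have h0 := eta_gt0 r0 r1; have h1 := eta_lt1 r0 r1.
rewrite /omega_r mobius_bounds//; congr (_ * omega _).
by rewrite -[RHS](mobiusK h0 h1 y0) [in RHS]/mobius mulNr.
Qed.

(** [kernel_weight] supplies the factor [(1 - r * u) ^ (- 3/2)] which completes
    [((1 + r * u) / (1 - r * u)) ^ (b - 3/2)] to the generating function. *)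
Lemma mellin_integrand_mobius r t y : 0 < r -> r < 1 -> 0 < y ->
  mellin_integrand r t (mobius (eta r) y) *
    ((1 - eta r ^+ 2) / (1 + eta r * y) ^+ 2)%:C =
  (2 * Num.sqrt 2 * (omega y / (y + 1) `^ (3 / 2)))%:C *
  psum (mp_poly (3 / 4 + 'i * (t / 2))) (r * cayley y).
Proof.
move=> r0 r1 y0; have ry := norm_r_cayley r0 r1 y0.
have [p0 q0] : 0 < 1 + r * cayley y /\ 0 < 1 - r * cayley y.
  by move: ry; rewrite ltr_norml => /andP[? ?]; split; lra.
rewrite /mellin_integrand omega_r_mobius// mp_generating_function//.
rewrite mulrAC -rmorphM mulrAC kernel_weight//.
rewrite mobius_cayley// cpowM ?invr_gt0// cpowV//.
set s := - (3 / 4) + _.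
have -> : 3 / 4 + 'i * (t / 2) - 3 / 2 = s by rewrite /s; field.
have -> : - (3 / 4 + 'i * (t / 2)) = - s + (- (3 / 2) : R)%:C.
  rewrite rmorphN fmorph_div !rmorph_nat /s.
  by field.
rewrite (cpowD _ (- s)) cpow_real// powRN.
set X := cpow _ s; set Y := cpow _ (- s).
rewrite (_ : 2 * Num.sqrt 2 / (y + 1) `^ (3 / 2) / (1 - r * cayley y) `^ (3 / 2) *
  omega y = 2 * Num.sqrt 2 * (omega y / (y + 1) `^ (3 / 2)) *
  ((1 - r * cayley y) `^ (3 / 2))^-1); last by ring.
rewrite rmorphM.
ring.
Qed.

End Kernel.

(** * The Mellin transform *)

Section MellinFlow.
Context {R : realType}.
Notation mu := (@lebesgue_measure R).
Implicit Types (r x y : R) (t : R[i]).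

Lemma continuous_cayley y : 0 < y -> {for y, continuous (@cayley R)}.
Proof.
move=> y0; have y1 : y + 1 != 0 by rewrite gt_eqF// addr_gt0.
apply: continuousM; first by apply: continuousB => //; exact: cst_continuous.
by apply: continuousV => //; apply: continuousD => //; exact: cst_continuous.
Qed.

Lemma is_derive_mobius h y : 0 < h -> 0 < y ->
  is_derive y (1 : R) (mobius h) ((1 - h ^+ 2) / (1 + h * y) ^+ 2).
Proof.
move=> h0 y0; have hy : 1 + h * y != 0 by rewrite gt_eqF// addr_gt0// mulr_gt0.
have d : is_derive y (1 : R) (fun y => (1 + h * y)^-1) (- h / (1 + h * y) ^+ 2).
  apply: is_derive_eq; rewrite /GRing.scale/= mulr1 add0r mul1r.
  by rewrite mulrC mulNr mulrN.
rewrite /mobius; apply: is_derive_eq; rewrite /GRing.scale/=.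
by field.
Qed.

Lemma continuous_mobius_deriv h y : 0 < h -> 0 < y ->
  {for y, continuous (fun y => (1 - h ^+ 2) / (1 + h * y) ^+ 2)}.
Proof.
move=> h0 y0; have hy : 1 + h * y != 0 by rewrite gt_eqF// addr_gt0// mulr_gt0.
apply: continuousM; first exact: cst_continuous.
apply: continuousV; first by rewrite expf_neq0.
have c : {for y, continuous (fun y => 1 + h * y)}.
  apply: continuousD; first exact: cst_continuous.
  by apply: continuousM => //; exact: cst_continuous.
exact: (continuousM c c).
Qed.

Lemma mobius_incr h x y : 0 < h -> h < 1 -> 0 < x -> x < y ->
  mobius h x < mobius h y.
Proof.
move=> h0 h1 x0 xy; have y0 := lt_trans x0 xy.
have hx : 0 < 1 + h * x by rewrite addr_gt0// mulr_gt0.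
have hy : 0 < 1 + h * y by rewrite addr_gt0// mulr_gt0.
have hh : 0 < 1 - h ^+ 2 by rewrite subr_gt0 exprn_ilt1// ltW.
rewrite /mobius ltr_pdivrMr// mulrAC ltr_pdivlMr// -subr_gt0.
rewrite (_ : _ - _ = (1 - h ^+ 2) * (y - x)); last by ring.
by rewrite mulr_gt0// subr_gt0.
Qed.

Lemma integrable_omega_weight :
  mu.-integrable `]0, +oo[ (EFin \o (fun y => omega y / (y + 1) `^ (3 / 2))).
Proof.
have mom : measurable_fun (`]0, +oo[ : set R) (@omega R).
  by apply/measurable_EFinP; case/integrableP: (@integrable_omega R).
apply: (le_integrable _ _ _ (@integrable_omega R)) => //.
  apply/measurable_EFinP.
  have -> : (fun y : R => omega y / (y + 1) `^ (3 / 2)) =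
      (fun y => omega y * (y + 1) `^ (- (3 / 2))).
    by apply/funext => y; rewrite powRN.
  apply: measurable_funM => //; apply: measurable_funTS.
  apply: (measurableT_comp (measurable_powR _)).
  exact: measurable_funD.
move=> y; rewrite /= in_itv/= andbT => y0; rewrite lee_fin normrM ler_piMr//.
have p0 : 0 < (y + 1) `^ (3 / 2) by rewrite powR_gt0// addr_gt0.
rewrite normfV (ger0_norm (ltW p0)) invf_le1//.
rewrite -[leLHS](powRr0 (y + 1)) ler_powR ?divr_ge0//.
by rewrite lerDr ltW.
Qed.

Lemma continuous_omega_r r x : 0 < r -> r < 1 -> eta r < x < (eta r)^-1 ->
  {for x, continuous (omega_r r)}.
Proof.
move=> r0 r1 xh; have h0 := eta_gt0 r0 r1; have h1 := eta_lt1 r0 r1.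
have hx1 : 0 < 1 - eta r * x.
  by case/andP: xh => _ xh; rewrite subr_gt0 mulrC -ltr_pdivlMr// mul1r.
have [m0 _] := mobiusNK h0 h1 xh.
have near_itv : nbhs x [set y | eta r < y < (eta r)^-1].
  have := @near_in_itvoo R (eta r) (eta r)^-1 x.
  by rewrite in_itv/= => /(_ xh); apply: filterS => y; rewrite in_itv.
have lin (c : R) : {for x, continuous (fun y => 1 + c * y)}.
  apply: continuousD; first exact: cst_continuous.
  by apply: continuousM => //; exact: cst_continuous.
have cs : {for x, continuous (fun y => Num.sqrt (1 + - eta r * y))}.
  by apply: continuous_comp; [exact: lin|exact: sqrt_continuous].
have cm : {for x, continuous (mobius (- eta r))}.
  apply: continuousM; first by apply: continuousD => //; exact: cst_continuous.
  by apply: continuousV; [rewrite mulNr gt_eqF|exact: lin].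
have co : {for x, continuous (fun y => omega (mobius (- eta r) y))}.
  by apply: continuous_comp => //; exact: continuous_omega.
have csV : {for x, continuous (fun y => (Num.sqrt (1 + - eta r * y))^-1)}.
  by apply: continuousV => //; rewrite mulNr gt_eqF// sqrtr_gt0.
have cc : {for x, continuous (cst ((1 + eta r) / Num.sqrt (1 - eta r)) : R -> R)}.
  exact: cst_continuous.
have E y : eta r < y < (eta r)^-1 -> omega_r r y =
    (1 + eta r) / Num.sqrt (1 - eta r) * (Num.sqrt (1 + - eta r * y))^-1 *
    omega (mobius (- eta r) y).
  by move=> yh; rewrite /omega_r yh /mobius mulNr mul1r.
have := continuousM (continuousM cc csV) co.
rewrite /prop_for /continuous_at E// => H.
apply: cvg_trans H; apply: near_eq_cvg; move: near_itv; apply: filterS => y /= yh.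
by rewrite E.
Qed.

(** The same argument serves for the real and the imaginary part, hence the
    abstract [part]. *)
Lemma mellin_part (part : R[i] -> R) r t : 0 < r -> r < 1 ->
  (forall a z, part (a%:C * z) = a * part z) ->
  (forall z, `|part z| <= normc z) ->
  (forall a w, part (psum a w) = limn (pseries (part \o a) w)) ->
  (forall x, eta r < x < (eta r)^-1 ->
    {for x, continuous (part \o mellin_integrand r t)}) ->
  mu.-integrable `]0, +oo[ (EFin \o (part \o mellin_integrand r t)) /\
  series (fun n => coef_c n * r ^+ n *
    part (mp_poly (3 / 4 + 'i * (t / 2)) n)) @ \oo -->
  \int[mu]_(x in `]0, +oo[) part (mellin_integrand r t x).
Proof.
move=> r0 r1 partZ part_le part_psum part_cont.
have h0 := eta_gt0 r0 r1; have h1 := eta_lt1 r0 r1.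
pose a := mp_poly (3 / 4 + 'i * (t / 2)) : nat -> R[i].
pose V y : R := omega y / (y + 1) `^ (3 / 2).
pose K := 1 + normc (2 * (3 / 4 + 'i * (t / 2)) - 3 / 2 : R[i]).
have mcay : measurable_fun (`]0, +oo[ : set R) (@cayley R).
  apply: open_continuous_measurable_fun; first exact: interval_open.
  by move=> y; rewrite inE/= in_itv/= andbT; exact: continuous_cayley.
have cay1 y : (`]0, +oo[%classic : set R) y -> `|cayley y| <= 1.
  by rewrite /= in_itv/= andbT; exact: cayley_le1.
have ag n : `|part (a n) * r ^+ n| <= growth K n * r ^+ n.
  rewrite normrM normrX (gtr0_norm r0) ler_wpM2r ?exprn_ge0 ?(ltW r0)//.
  exact: le_trans (part_le _) (mp_poly_growth _ _).
have cg : cvgn (series (fun n => growth K n * r ^+ n)).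
  by apply: is_cvg_growth => //; [rewrite addr_ge0 ?normc_ge0|exact: ltW].
have [iW cW] := @cvg_series_Rintegral _ _ R mu (`]0, +oo[ : set R) V _ _ _
  (measurable_itv _) integrable_omega_weight mcay cay1 ag cg.
have serE y : limn (series (fun n => part (a n) * r ^+ n * cayley y ^+ n)) =
    part (psum a (r * cayley y)).
  rewrite part_psum; congr (limn _); apply/funext => n; rewrite /pseries /series/=.
  by apply: eq_bigr => k _ /=; rewrite [in RHS]exprMn mulrA.
have subE y : 0 < y -> part (mellin_integrand r t (mobius (eta r) y)) *
    ((1 - eta r ^+ 2) / (1 + eta r * y) ^+ 2) =
    2 * Num.sqrt 2 * (V y * part (psum a (r * cayley y))).
  move=> y0; rewrite mulrC -partZ mulrC mellin_integrand_mobius// partZ.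
  by rewrite [RHS]mulrA.
have i2 : mu.-integrable `]0, +oo[ (EFin \o (fun y =>
    part (mellin_integrand r t (mobius (eta r) y)) *
    ((1 - eta r ^+ 2) / (1 + eta r * y) ^+ 2))).
  have := integrableZl _ (2 * Num.sqrt 2) iW => /(_ (measurable_itv _)).
  apply: eq_integrable => //.
  by move=> y; rewrite inE/= in_itv/= andbT => y0; rewrite subE// -serE.
have dpos y : 0 < y -> 0 <= (1 - eta r ^+ 2) / (1 + eta r * y) ^+ 2.
  by move=> y0; rewrite divr_ge0 ?sqr_ge0// subr_ge0 exprn_ile1// ltW.
have dM y (y0 : 0 < y) := is_derive_mobius h0 y0.
have cM y (y0 : 0 < y) := continuous_mobius_deriv h0 y0.
have iM x y (x0 : 0 < x) (xy : x < y) := mobius_incr h0 h1 x0 xy.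
have bM y (y0 : 0 < y) := mobius_bounds h0 h1 y0.
(* [omega_r] vanishes outside the interval from [eta] to [1 / eta], so this
   computes the whole Mellin integral *)
have [i3 e3] := integration_by_substitution_oy dM cM dpos iM bM
  (fun x => @mobiusNK R (eta r) x h0 h1) part_cont i2.
have itvE : `]0, +oo[ `&` `]eta r, (eta r)^-1[ = `]eta r, (eta r)^-1[%classic.
  apply/seteqP; split=> x /=; first by case.
  rewrite !in_itv/= andbT => /[dup] /andP[hx _] ->; split=> //.
  exact: lt_trans hx.
have part0 : part 0 = 0.
  by have := partZ 0 0; rewrite !mul0r.
have mellin_patch : part \o mellin_integrand r t =
    (part \o mellin_integrand r t) \_ `]eta r, (eta r)^-1[.
  apply/funext => x; rewrite patchE; case: ifPn => // xn.
  rewrite /= /mellin_integrand /omega_r ifF ?mul0r//.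
  by apply/negbTE; apply: contra xn; rewrite inE/= in_itv.
split.
  have -> : EFin \o (part \o mellin_integrand r t) =
      (EFin \o (part \o mellin_integrand r t)) \_ `]eta r, (eta r)^-1[.
    by rewrite restrict_EFin -mellin_patch.
  apply: integrableS (measurableT) _ _ _ => //.
  exact/(integrable_mkcond _ _).1.
rewrite [X in _ --> X](_ : _ =
    2 * Num.sqrt 2 * \int[mu]_(y in `]0, +oo[)
      (V y * limn (series (fun n => part (a n) * r ^+ n * cayley y ^+ n)))).
  rewrite [X in X @ _ --> _](_ : _ = (fun N => 2 * Num.sqrt 2 * series (fun n =>
      part (a n) * r ^+ n * \int[mu]_(y in `]0, +oo[) (V y * cayley y ^+ n)) N)).
    exact: cvgMr.
  apply/funext => N; rewrite /series/= mulr_sumr; apply: eq_bigr => n _.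
  rewrite /coef_c -/(V _) -/(cayley _).
  ring.
transitivity (\int[mu]_(x in `]eta r, (eta r)^-1[) part (mellin_integrand r t x)).
  by rewrite -itvE Rintegral_mkcondr -mellin_patch.
rewrite e3 -RintegralZl//.
apply: eq_Rintegral => y; rewrite inE/= in_itv/= andbT => y0.
by rewrite subE// serE.
Qed.

End MellinFlow.

Section FlowTerms.
Context {R : realType}.
Implicit Types (r x : R) (t : R[i]).

Lemma flow_termE r t n : flow_term r t n =
  (coef_c n * r ^+ n)%:C * mp_poly (3 / 4 + 'i * (t / 2)) n.
Proof.
rewrite -poly_f_mp /flow_term.
have -> : (coef_c n * r ^+ n)%:C = (coef_c n)%:C * r%:C ^+ n :> R[i].
  by rewrite -rmorphXn -rmorphM.
ring.
Qed.

Lemma continuous_mellin_integrand r t x : 0 < r -> r < 1 ->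
  eta r < x < (eta r)^-1 ->
  {for x, continuous (fun y => complex.Re (mellin_integrand r t y))} /\
  {for x, continuous (fun y => complex.Im (mellin_integrand r t y))}.
Proof.
move=> r0 r1 xh; have cw := continuous_omega_r r0 r1 xh.
have x0 : 0 < x by case/andP: xh => + _; apply: lt_trans; exact: eta_gt0.
have [cR cI] := is_cderive_continuous
  (is_cderive_cpow (- (3 / 4) + 'i * t / 2) (is_derive_id x 1) x0).
rewrite /mellin_integrand; split.
  rewrite (_ : (fun y => _) =
      fun y => omega_r r y * complex.Re (cpow y (- (3 / 4) + 'i * t / 2))).
    exact: continuousM.
  by apply/funext => y; rewrite Re_real_cplxM.
rewrite (_ : (fun y => _) =
    fun y => omega_r r y * complex.Im (cpow y (- (3 / 4) + 'i * t / 2))).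
  exact: continuousM.
by apply/funext => y; rewrite Im_real_cplxM.
Qed.
End FlowTerms.

Theorem theorem3p6 (R : realType) (r : R) (hr0 : 0 < r) (hr1 : r < 1)
    (t : R[i]) :
  [/\ cvgn (series (flow_term r t)),
      cintegrable `]0, +oo[ (mellin_integrand r t) &
      poisson_flow r t = cintegral `]0, +oo[ (mellin_integrand r t)].
Proof.
have [iR cR] := @mellin_part R (@complex.Re R) r t hr0 hr1
  Re_real_cplxM Re_le_normc (fun _ _ => erefl)
  (fun x xh => (continuous_mellin_integrand t hr0 hr1 xh).1).
have [iI cI] := @mellin_part R (@complex.Im R) r t hr0 hr1
  Im_real_cplxM Im_le_normc (fun _ _ => erefl)
  (fun x xh => (continuous_mellin_integrand t hr0 hr1 xh).2).
have cv : series (flow_term r t) @ \oo -->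
    (cintegral `]0, +oo[ (mellin_integrand r t) : R[i]^o).
  apply: cvg_cplx.
    rewrite [X in X @ _ --> _](_ : _ = series (fun n => coef_c n * r ^+ n *
        complex.Re (mp_poly (3 / 4 + 'i * (t / 2)) n)))//.
    apply/funext => N; rewrite /series/= Re_cplx_sum; apply: eq_bigr => n _.
    by rewrite flow_termE Re_real_cplxM.
  rewrite [X in X @ _ --> _](_ : _ = series (fun n => coef_c n * r ^+ n *
      complex.Im (mp_poly (3 / 4 + 'i * (t / 2)) n)))//.
  apply/funext => N; rewrite /series/= Im_cplx_sum; apply: eq_bigr => n _.
  by rewrite flow_termE Im_real_cplxM.
split.
- by apply/cvg_ex; eexists; exact: cv.
- exact: conj iR iI.
- exact: (cvg_lim (@norm_hausdorff _ R[i]^o) cv).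
Qed.
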